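(* Let $\delta\in\mathbb{R}$. The algebra of $\mathrm{sp}_{2n+2}$-invariant differential operators from $R_\delta$ into $R_\delta$ is generated by $i_\alpha$ and $X$, in the following precise sense: for all $k,\ell\in\mathbb{N}$, the space of $\mathrm{sp}_{2n+2}$-invariant differential operators from $R^\ell_\delta$ into $R^k_\delta$ is spanned by $$\{X^m\circ i_\alpha^{\ell+m-k}\;:\;\sup(0,k-\ell)\le m\le k\}.$$
   Context: Let $n\ge1$, $(p_1,\dots,p_n,q^1,\dots,q^n,t)$ the canonical coordinates of $\mathbb{R}^{2n+1}$, $\alpha=\frac12(\sum_k(p_kdq^k-q^kdp_k)-dt)$ the standard contact form, and $\mathcal{E}_s=\sum_k(p_k\partial_{p_k}+q^k\partial_{q^k})$. The contact Hamiltonian vector field of $h\in C^\infty(\mathbb{R}^{2n+1})$ is $$X_h=\sum_k(\partial_{p_k}h\,\partial_{q^k}-\partial_{q^k}h\,\partial_{p_k})+\mathcal{E}_s(h)\,\partial_t-\partial_th\,\mathcal{E}_s-2h\,\partial_t.$$ The Lie algebra $\mathrm{sp}_{2n+2}$ of infinitesimal projective contact transformations is $\{X_h: h\text{ a polynomial of degree}\le2\text{ in }(p,q,t)\}$; it is isomorphic to $\mathrm{sp}(2n+2,\mathbb{R})$. For $k\in\mathbb{N}$, $\delta\in\mathbb{R}$, $\mathcal{S}^k_\delta(\mathbb{R}^{2n+1})=\Gamma(S^kT\mathbb{R}^{2n+1}\otimes\mathbb{F}_\delta)$ is the space of symmetric contravariant $k$-tensor fields with values in $\delta$-densities ($\mathbb{F}_\delta$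 the line bundle of $\delta$-densities, trivialized by the power of the standard density). Its elements are viewed as polynomials $S(\xi)$, homogeneous of degree $k$ in the fiber coordinates $\xi=(\xi_{p_i},\xi_{q^i},\xi_t)$, with coefficients in $C^\infty(\mathbb{R}^{2n+1})$. A vector field $Z=Z^i\partial_i$ acts on $P\in\mathcal{S}^k_\delta$ by $L_ZP=Z(P)-\partial_jZ^i\,\xi_i\,\partial_{\xi_j}P+\delta\,\partial_iZ^i\,P$. Put $R^k_\delta=\mathcal{S}^k_{\delta+\frac{k}{n+1}}(\mathbb{R}^{2n+1})$ and $R_\delta=\bigoplus_{k\in\mathbb{N}}R^k_\delta$. An operator is $\mathrm{sp}_{2n+2}$-invariant if it commutes with the actions $L_Z$ for all $Z\in\mathrm{sp}_{2n+2}$. The operator $i_\alpha:\mathcal{S}^k_\delta\to\mathcal{S}^{k-1}_{\delta-\frac1{n+1}}$ is $$(i_\alpha S)(\xi)=\tfrac12\Big(\sum_j(p_j\partial_{\xi_{q^j}}-q^j\partial_{\xi_{p_j}})-\partial_{\xi_t}\Big)S(\xi)$$ (zero for $k=0$), so $i_\alpha:R^k_\delta\to R^{k-1}_\delta$. The generalized Hamiltonian $X:\mathcal{S}^k_\delta\to\mathcal{S}^{k+1}_{\delta+\frac1{n+1}}$ is $$X(S)(\xi)=\sum_j(\xi_{q^j}\partial_{p_j}-\xi_{p_j}\partial_{q^j})S(\xi)+\xi_t\,\mathcal{E}_sS(\xi)-\Big(\sum_j(p_j\xi_{p_j}+q^j\xi_{q^j})\Big)\partial_tS(\xi)+\big(2(n+1)\delta-k\big)\xi_tS(\xi),$$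 so $X:R^k_\delta\to R^{k+1}_\delta$, the constant in the last term being computed with the actual density weight $\delta+\frac{k}{n+1}$ of elements of $R^k_\delta$, i.e. it equals $2(n+1)\delta+k$ there. $X^0$ and $i_\alpha^0$ are identity maps. *)

(* Defs.v *)
From HB Require Import structures.
From mathcomp Require Import all_boot all_order all_algebra.
From mathcomp Require Import mpoly.
From mathcomp Require Import boolp classical_sets functions reals topology.
From mathcomp Require Import normedtype derive.

Set Implicit Arguments.
Unset Strict Implicit.
Unset Printing Implicit Defensive.

Import Order.TTheory GRing.Theory Num.Theory.
Import numFieldNormedType.Exports.

Local Open Scope classical_set_scope.
Local Open Scope ring_scope.

Section SmoothFunctions.
Variables (R : realType) (N : nat).
Implicit Types (f g : 'rV[R]_N -> R) (i : 'I_N) (k : nat).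

Definition basis_vec i : 'rV[R]_N := delta_mx 0 i.

Fixpoint Ck k f : Prop :=
  if k is k'.+1 then
    continuous f /\
    forall i, (forall x, derivable f x (basis_vec i)) /\
              Ck k' ('D_(basis_vec i) f)
  else continuous f.

Definition smooth : {pred 'rV[R]_N -> R} := fun f => `[< forall k, Ck k f >].

Lemma smoothP f : reflect (forall k, Ck k f) (f \in smooth).
Proof. exact: asboolP. Qed.

Lemma CkW k f : Ck k.+1 f -> Ck k f.
Proof.
elim: k f => [|k IHk] f /=; first by case.
by case=> cf df; split=> // i; have [dfi ckf] := df i; split=> //; exact: IHk.
Qed.

Lemma Ck_continuous k f : Ck k f -> continuous f.
Proof. by case: k => [|k] //= []. Qed.

Lemma Ck_cst k (a : R) : Ck k (cst a).
Proof.
elim: k a => [|k IHk] a; first exact: cst_continuous.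
split=> [|i]; first exact: cst_continuous.
split=> [x|]; first exact: derivable_cst.
rewrite (_ : 'D_(basis_vec i) (cst a) = cst 0) //.
by apply/funext => x; rewrite derive_cst.
Qed.

Lemma CkD k f g : Ck k f -> Ck k g -> Ck k (f + g).
Proof.
elim: k f g => [|k IHk] f g /=.
  by move=> cf cg x; exact: (continuousD (cf x) (cg x)).
move=> [cf df] [cg dg]; split=> [x|i].
  exact: (continuousD (cf x) (cg x)).
have [dfi kf] := df i; have [dgi kg] := dg i; split=> [x|].
  by apply: derivableD.
rewrite (_ : 'D_(basis_vec i) (f + g) =
             'D_(basis_vec i) f + 'D_(basis_vec i) g); first exact: IHk.
by apply/funext => x; rewrite deriveD.
Qed.

Lemma CkM k f g : Ck k f -> Ck k g -> Ck k (f * g).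
Proof.
elim: k f g => [|k IHk] f g.
  by move=> /= cf cg x; exact: (continuousM (cf x) (cg x)).
move=> kf kg; have [cf df] := kf; have [cg dg] := kg.
split=> [x|i].
  exact: (continuousM (cf x) (cg x)).
have [dfi kdf] := df i; have [dgi kdg] := dg i; split=> [x|].
  by apply: derivableM.
rewrite (_ : 'D_(basis_vec i) (f * g) =
             f * 'D_(basis_vec i) g + g * 'D_(basis_vec i) f).
  by apply: CkD; apply: IHk => //; exact: CkW.
by apply/funext => x; rewrite deriveM.
Qed.

Lemma smooth_cst (a : R) : cst a \in smooth.
Proof. by apply/smoothP => k; exact: Ck_cst. Qed.

Lemma smooth_subring_closed : subring_closed smooth.
Proof.
split=> [|f g /smoothP sf /smoothP sg|f g /smoothP sf /smoothP sg].
- exact: smooth_cst.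
- apply/smoothP => k; apply: CkD => //.
  rewrite (_ : - g = cst (-1) * g); first by apply: CkM => //; exact: Ck_cst.
  by apply/funext => x; rewrite !fctE mulN1r.
- by apply/smoothP => k; exact: CkM.
Qed.

HB.instance Definition _ :=
  GRing.isSubringClosed.Build ('rV[R]_N -> R) smooth smooth_subring_closed.

Record Cinf := MkCinf {
  Cinf_fun :> 'rV[R]_N -> R;
  Cinf_smooth : Cinf_fun \in smooth }.

HB.instance Definition _ := [isSub for Cinf_fun].
HB.instance Definition _ := [Choice of Cinf by <:].
HB.instance Definition _ := [SubChoice_isSubComNzRing of Cinf by <:].

Definition constC (a : R) : Cinf := MkCinf (smooth_cst a).

Lemma smooth_coord i : (fun x : 'rV[R]_N => x 0 i) \in smooth.
Proof.
apply/smoothP; case=> [|k] /=; first exact: coord_continuous.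
split=> [|j]; first exact: coord_continuous.
have dc x : is_derive x (basis_vec j) (fun x : 'rV[R]_N => x 0 i)
              (basis_vec j 0 i).
  have e : \forall h \near 0^', h^-1 *: (((fun x : 'rV[R]_N => x 0 i) \o shift x)
      (h *: basis_vec j) - x 0 i) = basis_vec j 0 i.
    near=> h; rewrite /= !mxE addrK scalerA mulVf ?scale1r //.
    by near: h; exact: nbhs_dnbhs_neq.
  have c : (fun h : R => h^-1 *: (((fun x : 'rV[R]_N => x 0 i) \o shift x)
      (h *: basis_vec j) - x 0 i)) @ 0^' --> basis_vec j 0 i.
    by apply: cvg_near_cst.
  by apply: DeriveDef; [apply/cvg_ex; exists (basis_vec j 0 i) | exact: cvg_lim].
split=> [x|]; first exact: ex_derive.
rewrite (_ : 'D_(basis_vec j) _ = cst (basis_vec j 0 i)); first exact: Ck_cst.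
by apply/funext => x; rewrite derive_val.
Unshelve. all: by end_near. Qed.

Definition coordC i : Cinf := MkCinf (smooth_coord i).

Lemma smooth_deriv i (f : Cinf) : 'D_(basis_vec i) f \in smooth.
Proof.
apply/smoothP => k.
by have /smoothP/(_ k.+1) [_ /(_ i) []] := Cinf_smooth f.
Qed.

Definition dC i (f : Cinf) : Cinf := MkCinf (smooth_deriv i f).

Lemma dC_is_additive i : zmod_morphism (dC i).
Proof.
move=> f g; apply/val_inj/funext => x /=.
have d (h : Cinf) y : derivable h y (basis_vec i).
  by have /smoothP/(_ 1%N) [_ /(_ i) []] := Cinf_smooth h.
by rewrite -[LHS]/('D_(basis_vec i) (Cinf_fun f - Cinf_fun g) x) deriveB.
Qed.

HB.instance Definition _ i :=
  GRing.isZmodMorphism.Build Cinf Cinf (dC i) (dC_is_additive i).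

Definition dmultiC (beta : 'X_{1..N}) (f : Cinf) : Cinf :=
  foldr (fun i (g : Cinf) => iter (beta i) (dC i) g) f (enum 'I_N).

End SmoothFunctions.

Arguments constC {R N} a.
Arguments coordC {R N} i.

(* A symmetric contravariant tensor field is a polynomial in the fiber        *)
(* coordinates xi_i = 'X_i with smooth coefficients; S^k is the subspace      *)
(* [k.-homog].  As density bundles are trivialized, the weight enters only    *)
(* through the operators (argument [w] below).                                *)
Section TensorFields.
Variables (R : realType) (N : nat).
Notation C := (Cinf R N).
Notation symb := {mpoly C[N]}.
Implicit Types (P S : symb) (Z : 'rV[C]_N) (w : R) (D : symb -> symb).

(* derivative along the base coordinate i; the fiber one is [mderiv i]        *)
Definition dbase (i : 'I_N) S : symb := map_mpoly (dC i) S.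

(* [Z] is the row of components of the vector field                           *)
Definition Lie w Z P : symb :=
  \sum_i Z 0 i *: dbase i P
  - \sum_i \sum_j dC j (Z 0 i) *: ('X_i * mderiv j P)
  + (constC w * \sum_i dC i (Z 0 i)) *: P.

(* Finite-order linear differential operators with smooth coefficients from   *)
(* S^l to S^k.  D is only considered on S^l, so the S@_m with mdeg m < l,     *)
(* which vanish there, are harmless.                                          *)
Definition is_diff_op (l k : nat) D : Prop :=
  (forall S, S \is l.-homog -> D S \is k.-homog) /\
  exists (r : nat) (A : 'X_{1..N} -> 'X_{1..N} -> symb),
    forall S, S \is l.-homog ->
      D S = \sum_(beta : 'X_{1..N < r.+1}) \sum_(m : 'X_{1..N < l.+1})
              dmultiC beta S@_m *: A beta m.

End TensorFields.

(* R^(2n+1) with coordinates (p_1..p_n, q^1..q^n, t), in this order.          *)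
Definition cdim (n : nat) : nat := (n + n + 1)%N.

Section Contact.
Variables (R : realType) (n : nat).
Notation N := (cdim n).
Notation C := (Cinf R N).
Notation symb := {mpoly C[N]}.
Implicit Types (h f : C) (S : symb) (w delta : R) (k l m : nat) (j : 'I_n).

Definition ip j : 'I_N := lshift 1 (lshift n j).
Definition iq j : 'I_N := lshift 1 (rshift n j).
Definition it : 'I_N := rshift (n + n) ord0.

Definition pc j : C := coordC (ip j).
Definition qc j : C := coordC (iq j).

Definition vfield (i : 'I_N) : 'rV[C]_N := delta_mx 0 i.

Definition eulerC f : C :=
  \sum_j (pc j * dC (ip j) f + qc j * dC (iq j) f).

Definition contact_field h : 'rV[C]_N :=
  \sum_j (dC (ip j) h *: vfield (iq j) - dC (iq j) h *: vfield (ip j))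
  + eulerC h *: vfield it
  - dC it h *: (\sum_j (pc j *: vfield (ip j) + qc j *: vfield (iq j)))
  - (h *+ 2) *: vfield it.

(* [msize Q <= 3] means that Q has degree at most 2 *)
Definition poly_le2 h : Prop :=
  exists Q : {mpoly R[N]},
    (msize Q <= 3)%N /\ forall x : 'rV[R]_N, h x = Q.@[fun i => x 0 i].

Definition in_sp (Z : 'rV[C]_N) : Prop :=
  exists h : C, poly_le2 h /\ Z = contact_field h.

Definition ialpha S : symb :=
  constC (2^-1) *:
    (\sum_j (pc j *: mderiv (iq j) S - qc j *: mderiv (ip j) S)
     - mderiv it S).

Definition eulerS S : symb :=
  \sum_j (pc j *: dbase (ip j) S + qc j *: dbase (iq j) S).

(* generalized Hamiltonian on S^k with density weight w *)
Definition genham w k S : symb :=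
  \sum_j ('X_(iq j) * dbase (ip j) S - 'X_(ip j) * dbase (iq j) S)
  + 'X_it * eulerS S
  - (\sum_j (pc j *: 'X_(ip j) + qc j *: 'X_(iq j))) * dbase it S
  + constC (2 * n.+1%:R * w - k%:R) *: ('X_it * S).

(* density weight of the elements of R^k_delta *)
Definition Rweight delta k : R := delta + k%:R / n.+1%:R.

Definition Xham delta k S : symb := genham (Rweight delta k) k S.

(* X^m on R^k_delta, with values in R^(k+m)_delta *)
Fixpoint Xpow delta k m S : symb :=
  if m is m'.+1 then Xham delta (k + m') (Xpow delta k m' S) else S.

Definition sp_invariant delta l k (D : symb -> symb) : Prop :=
  forall Z, in_sp Z -> forall S, S \is l.-homog ->
    Lie (Rweight delta k) Z (D S) = D (Lie (Rweight delta l) Z S).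

(* X^m o i_alpha^(l+m-k) on R^l_delta, for k <= l + m and m <= k *)
Definition gen_op delta l k m S : symb :=
  Xpow delta (k - m) m (iter (l + m - k) ialpha S).

End Contact.

(* Main.v *)
(* That i_alpha and X are invariant is checked on generators: for a vector field   *)
(* Z = X_h the Lie derivative, i_alpha and the first-order part of X are, up to     *)
(* zeroth-order terms, derivations of the algebra of symbols, so their brackets are *)
(* determined by their values on functions and on the xi_i.  The identity for X    *)
(* holds because the third derivatives of h vanish.                                 *)
(*                                                                                  *)
(* Conversely let D be invariant, let p, q be the first pair of Darboux coordinates *)
(* and let phi(S) be the coefficient of xi_p^k in (D S)(0).  The weights of D under *)
(* the diagonal fields X_t and X_(pq) make phi vanish on every monomial             *)
(* x^b xi^m except q^(k-a) xi_p^a xi_t^(l-a), a <= min(k,l).  If phi vanishes on     *)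
(* these too, the fields X_(q v), which are zero at 0 and act on fibers as          *)
(* xi_p d/d(xi_v), show that D S vanishes at 0 for all polynomial S; the Heisenberg *)
(* fields X_1, X_(p_j), X_(q_j) then give D S = 0 for polynomial S by induction on  *)
(* the weight, and Taylor polynomials extend this to smooth S.  So D is determined  *)
(* by min(k,l)+1 numbers, which can be read off instead on the tensors              *)
(* q^(k-a) (xi_p - q xi_t)^a xi_t^(l-a); on these X^m o i_alpha^(l+m-k) contributes *)
(* only for m = k - a, with a nonzero value for every delta.                        *)

(* That the combinations are invariant ([gen_comb_invariant]) rests on [lie_der], [ialph] and
   [ham_der] being derivations of the algebra of symbols, so that [derivation_ext] reduces each
   commutation rule to functions and fiber coordinates. Both brackets leave a factor 2 d_t h up to
   sign. The divergence of X_h is -2(n+1) d_t h ([div_cfield]), so a weight shift by 1/(n+1) absorbs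
   this factor; [lie_gham] and [lie_ialph] follow.

   The converse rests on [invariant_eq0]: an invariant operator vanishes as soon as min(k,l)+1
   numbers do. Its four ingredients use different symmetries. Diagonal fields compare weights
   ([test_coef_eq0]), fields vanishing at the origin move between fiber monomials there
   ([coef_origin_eq0]), Heisenberg fields propagate vanishing from the origin to all points
   ([heis_invariants_eq0], [opf_monT_eq0]), and Taylor polynomials pass from polynomial to smooth
   tensors ([opf_eq0_on_polynomials]).

   After the change of basis [monT_test], the matrix of these numbers on the generators is diagonal
   ([gen_test]) with nonzero entries ([test_value_neq0]). Hence some combination of generators has
   the same numbers as the given operator, and the difference is zero. *)
Require Import Defs.
From HB Require Import structures.
From mathcomp Require Import all_boot all_order all_algebra.
From mathcomp Require Import mpoly ring zify.
From mathcomp Require Import boolp functions reals topology.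
From mathcomp Require Import normedtype derive realfun.

Set Implicit Arguments.
Unset Strict Implicit.
Unset Printing Implicit Defensive.

Import Order.TTheory GRing.Theory Num.Theory.
Import numFieldNormedType.Exports.

Local Open Scope ring_scope.

(** * Calculus of smooth functions *)

Section SmoothCalculus.
Variables (R : realType) (N : nat).
Notation V := 'rV[R]_N.
Notation C := (Cinf R N).
Implicit Types (f g : C) (i j : 'I_N) (x : V).

Lemma Cinf_ext f g : (forall x, f x = g x) -> f = g.
Proof. by move=> fg; apply/val_inj/funext. Qed.

Lemma CinfD f g x : (f + g) x = f x + g x. Proof. by []. Qed.
Lemma CinfM f g x : (f * g) x = f x * g x. Proof. by []. Qed.
Lemma constCE (a : R) x : (constC a : C) x = a. Proof. by []. Qed.
Lemma coordCE i x : (coordC i : C) x = x 0 i. Proof. by []. Qed.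

Lemma derivable_Cinf f x i : derivable f x (basis_vec R i).
Proof. by have /smoothP/(_ 1%N) [_ /(_ i) []] := Cinf_smooth f. Qed.

Arguments derivable_Cinf : clear implicits.

Lemma continuous_Cinf f : continuous f.
Proof. by have /smoothP/(_ 0%N) := Cinf_smooth f. Qed.

Lemma dCE i f x : dC i f x = 'D_(basis_vec R i) f x. Proof. by []. Qed.

Lemma is_derive_line (f : C) x i (s : R) :
  is_derive s 1 (fun s : R => f (x + s *: basis_vec R i))
    (dC i f (x + s *: basis_vec R i)).
Proof.
have E : (fun h : R => h^-1 *: (((fun s : R => f (x + s *: basis_vec R i)) \o shift s)
      (h *: 1) - f (x + s *: basis_vec R i))) =
   (fun h : R => h^-1 *: ((f \o shift (x + s *: basis_vec R i))
      (h *: basis_vec R i) - f (x + s *: basis_vec R i))).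
  apply/funext => h /=; congr (_ *: (f _ - _)).
  by rewrite [h%:A]mulr1 scalerDl addrCA addrA.
have := derivable_Cinf f (x + s *: basis_vec R i) i.
split; first by rewrite /derivable E.
by rewrite /derive E.
Qed.

Lemma cinf_increment f x i (h : R) : 0 < h ->
  exists2 s, 0 < s < h &
    f (x + h *: basis_vec R i) - f x = dC i f (x + s *: basis_vec R i) * h.
Proof.
move=> h0; have [||s sh E] := @MVT R (fun s => f (x + s *: basis_vec R i))
    (fun s => dC i f (x + s *: basis_vec R i)) 0 h h0.
- by move=> s _; exact: is_derive_line.
- by apply: derivable_within_continuous => s _; have [] := is_derive_line f x i s.
exists s; first by rewrite in_itv in sh.
by rewrite subr0 scale0r addr0 in E.
Qed.

(** The mean value theorem is used twice: along i for the difference of f on two parallel lines a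
    step h apart in direction j, then along j for the i-th partial derivative. *)
Lemma second_increment f x i j (h : R) : 0 < h ->
  exists s s', [/\ 0 < s < h, 0 < s' < h &
    f (x + h *: basis_vec R i + h *: basis_vec R j) - f (x + h *: basis_vec R j)
      - (f (x + h *: basis_vec R i) - f x)
    = dC j (dC i f) (x + s *: basis_vec R i + s' *: basis_vec R j) * h * h].
Proof.
move=> h0; set u := basis_vec R i; set v := basis_vec R j.
have d (s : R) : is_derive s (1 : R)
    ((fun s : R => f (x + h *: v + s *: u)) - (fun s : R => f (x + s *: u)))
    (dC i f (x + h *: v + s *: u) - dC i f (x + s *: u)).
  by apply: is_deriveB; exact: is_derive_line.
have [|s sh E] := @MVT R
   ((fun s : R => f (x + h *: v + s *: u)) - (fun s : R => f (x + s *: u)))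
   (fun s => dC i f (x + h *: v + s *: u) - dC i f (x + s *: u)) 0 h h0.
  by apply: derivable_within_continuous => s _; have [] := d s.
have [s' s'h E'] := cinf_increment (dC i f) (x + s *: u) j h0.
exists s, s'; split => //.
move: E; rewrite !fctE subr0 scale0r !addr0 => E.
rewrite -E' [X in _ = (_ X - _) * _]addrAC -E (addrAC x (h *: u)); ring.
Qed.

(** Schwarz's theorem. The second difference is symmetric in i and j, so a value of one mixed
    derivative near x equals a value of the other near x; continuity at x concludes. *)
Lemma dC_comm i j f : dC i (dC j f) = dC j (dC i f).
Proof.
apply: Cinf_ext => x; set u := basis_vec R i; set v := basis_vec R j.
apply/eqP; rewrite -subr_eq0 -normr_le0; apply/ler_addgt0Pr => e e0; rewrite add0r.
have e2 : 0 < e / 2 by rewrite divr_gt0.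
have near0 (g : C) : \forall p \near (0 : R * R),
    `|g x - g (x + p.1 *: u + p.2 *: v)| < e / 2.
  have c : {for (0 : R * R), continuous (fun p : R * R => g (x + p.1 *: u + p.2 *: v))}.
    apply: (@continuous_comp _ _ _ (fun p : R * R => x + p.1 *: u + p.2 *: v) g);
      last exact: continuous_Cinf.
    apply: cvgD; first apply: cvgD; first exact: cvg_cst.
      by apply: cvgZr_tmp; exact: cvg_fst.
    by apply: cvgZr_tmp; exact: cvg_snd.
  have /cvgrPdist_lt /(_ _ e2) := c.
  by rewrite /= !scale0r !addr0.
have [d /= d0 H] : exists2 d : R, 0 < d & forall s s', 0 < s < d -> 0 < s' < d ->
   `|dC j (dC i f) x - dC j (dC i f) (x + s *: u + s' *: v)| < e / 2 /\
   `|dC i (dC j f) x - dC i (dC j f) (x + s *: u + s' *: v)| < e / 2.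
  have := near0 (dC j (dC i f)); have := near0 (dC i (dC j f)).
  move=> /nbhs_ballP[d1 /= d10 H1] /nbhs_ballP[d2 /= d20 H2].
  exists (Num.min d1 d2); first by rewrite lt_min d10.
  move=> s s' /andP[s0]; rewrite lt_min => /andP[s1 s2] /andP[s'0].
  rewrite lt_min => /andP[s'1 s'2].
  by split; [apply: (H2 (s, s')) | apply: (H1 (s, s'))];
    split; rewrite /ball /= sub0r normrN gtr0_norm.
have h0 : 0 < d / 2 by rewrite divr_gt0.
have hd : d / 2 < d by rewrite ltr_pdivrMr // ltr_pMr // ltr1n.
have [s [s' [/andP[s0 sh] /andP[s'0 s'h] E]]] := second_increment f x i j h0.
have [t [t' [/andP[t0 th] /andP[t'0 t'h] E']]] := second_increment f x j i h0.
rewrite -/u -/v (addrAC x (d / 2 *: u) (d / 2 *: v)) in E.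
rewrite -/u -/v (addrAC x (t *: v) (t' *: u)) in E'.
have h0' : d / 2 != 0 by rewrite lt0r_neq0.
have cancelh (a b c l r : R) : c != 0 -> l = a * c * c -> r = b * c * c -> l = r -> a = b.
  by move=> c0 -> -> /(mulIf c0) /(mulIf c0).
have {E' h0'} E := cancelh _ _ _ _ _ h0' E E' ltac:(ring).
have lt_d r : 0 < r -> r < d / 2 -> 0 < r < d by move=> -> /lt_trans ->.
have [H1 _] := H s s' (lt_d _ s0 sh) (lt_d _ s'0 s'h).
have [_ H2] := H t' t (lt_d _ t'0 t'h) (lt_d _ t0 th).
have close (a b p q : R) : p = q -> `|a - p| < e / 2 -> `|b - q| < e / 2 -> `|b - a| <= e.
  move=> -> ap bq; rewrite [leRHS]splitr; rewrite distrC in ap.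
  exact: le_trans (ler_distD q b a) (ltW (ltrD bq ap)).
exact: close E H1 H2.
Qed.

(** The point x is reached from 0 by finitely many moves along coordinate lines, on each of which f
    is constant by the one-variable result. *)
Lemma gradient0_const f : (forall i, dC i f = 0) -> forall x y, f x = f y.
Proof.
move=> df.
have shift1 x i s : f (x + s *: basis_vec R i) = f x.
  have := @is_derive_0_is_cst _ (fun s => f (x + s *: basis_vec R i)) s 0.
  rewrite scale0r addr0; apply => z.
  by have := is_derive_line f x i z; rewrite df.
suff fE x : f x = f 0 by move=> x y; rewrite fE fE.
rewrite [x]row_sum_delta.
elim/big_rec: _ => // i y _ <-; rewrite addrC; exact: shift1.
Qed.

Lemma dC_const i (a : R) : dC i (constC a : C) = 0.
Proof. by apply: Cinf_ext => x; rewrite dCE derive_cst. Qed.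

Lemma dCM i f g : dC i (f * g) = dC i f * g + f * dC i g.
Proof.
apply: Cinf_ext => x; rewrite CinfD !CinfM !dCE.
have dd (h : C) : derivable h x (basis_vec R i) := derivable_Cinf h x i.
rewrite -[LHS]/('D_(basis_vec R i) (Cinf_fun f * Cinf_fun g) x) deriveM //.
by rewrite addrC /GRing.scale /= [X in X + _]mulrC.
Qed.

Lemma dC_coord i j : dC i (coordC j : C) = (i == j)%:R.
Proof.
apply: Cinf_ext => x; rewrite dCE /derive.
apply/cvg_lim => //; apply: cvg_near_cst; near=> h.
rewrite /= !mxE addrK eqxx /= scalerA mulVf ?scale1r; last by near: h; exact: nbhs_dnbhs_neq.
by rewrite eq_sym; case: eqP => _.
Unshelve. all: by end_near. Qed.

Lemma constC_is_additive : zmod_morphism (@constC R N).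
Proof. by move=> a b; exact: Cinf_ext. Qed.
Lemma constC_is_multiplicative : monoid_morphism (@constC R N).
Proof. by split=> [|a b]; exact: Cinf_ext. Qed.
HB.instance Definition _ :=
  GRing.isZmodMorphism.Build R C (@constC R N) constC_is_additive.
HB.instance Definition _ :=
  GRing.isMonoidMorphism.Build R C (@constC R N) constC_is_multiplicative.

End SmoothCalculus.
Arguments derivable_Cinf {R N}.

(** * Symbols over an abstract ring of functions *)

(* The only properties of [Cinf] that are used; working over [Cinf] itself would *)
(* let unification unfold its ring structure and diverge.                        *)
Record coord_ring (R : numFieldType) (N : nat) := CoordRing {
  cr_ring :> comNzRingType;
  der : 'I_N -> {additive cr_ring -> cr_ring};
  scal : {rmorphism R -> cr_ring};
  crd : 'I_N -> cr_ring;
  evc : 'rV[R]_N -> {rmorphism cr_ring -> R};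
  derM : forall i f g, der i (f * g) = der i f * g + f * der i g;
  der_comm : forall i j f, der i (der j f) = der j (der i f);
  der_scalar : forall i a, der i (scal a) = 0;
  der_crd : forall i j, der i (crd j) = (i == j)%:R;
  evc_scal : forall x a, evc x (scal a) = a;
  evc_crd : forall x i, evc x (crd i) = x 0 i;
  evc_inj : forall f g, (forall x, evc x f = evc x g) -> f = g;
  gradient0 : forall f, (forall i, der i f = 0) -> forall x y, evc x f = evc y f
}.
Arguments scal {R N c}.
Arguments crd {R N c}.

Section SymbolDerivations.
Variables (R : numFieldType) (N : nat) (C : coord_ring R N).
Notation symb := {mpoly C[N]}.
Implicit Types (c : C) (P S : symb) (i j : 'I_N) (m : 'X_{1..N}).

Definition dsymb i S : symb := map_mpoly (der C i) S.

Lemma mcoeff_dsymb i S m : (dsymb i S)@_m = der C i S@_m.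
Proof. exact: mcoeff_map_mpoly. Qed.

Lemma dsymb_is_additive i : zmod_morphism (dsymb i).
Proof. exact: raddfB. Qed.
HB.instance Definition _ i :=
  GRing.isZmodMorphism.Build symb symb (dsymb i) (dsymb_is_additive i).

Lemma dsymbC i c : dsymb i c%:MP = (der C i c)%:MP.
Proof. exact: map_mpolyC. Qed.

Lemma der_nat i (b : nat) : der C i (b%:R) = 0.
Proof. by rewrite -(rmorph_nat (@scal R N C)) der_scalar. Qed.

Lemma dsymbX i m : dsymb i 'X_[m] = 0.
Proof. by apply/mpolyP => k; rewrite mcoeff_dsymb mcoeffX der_nat mcoeff0. Qed.

Lemma dsymbM i P S : dsymb i (P * S) = dsymb i P * S + P * dsymb i S.
Proof.
apply/mpolyP => m; rewrite mcoeff_dsymb mcoeffD !mcoeffM raddf_sum -big_split /=.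
by apply: eq_bigr => k _; rewrite derM !mcoeff_dsymb.
Qed.

Lemma dsymbZ i c S : dsymb i (c *: S) = der C i c *: S + c *: dsymb i S.
Proof. by rewrite -!mul_mpolyC dsymbM dsymbC. Qed.

Definition derivation (d : symb -> symb) :=
  zmod_morphism d /\ forall P S, d (P * S) = d P * S + P * d S.

Lemma derivation0 d : derivation d -> d 0 = 0.
Proof. by case=> db _; have := db 0 0; rewrite !subrr. Qed.

Lemma derivationN d P : derivation d -> d (- P) = - d P.
Proof. by move=> dd; rewrite -sub0r dd.1 derivation0 // sub0r. Qed.

Lemma derivationD d P S : derivation d -> d (P + S) = d P + d S.
Proof. by move=> dd; have := dd.1 P (- S); rewrite (derivationN S dd) !opprK. Qed.

Lemma derivation_sum d (I : Type) (r : seq I) (F : I -> symb) : derivation d ->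
  d (\sum_(i <- r) F i) = \sum_(i <- r) d (F i).
Proof.
move=> dd; elim/big_rec2: _ => [|i _ y _ <-]; first exact: derivation0.
exact: derivationD.
Qed.

Lemma derivation_dsymb i : derivation (dsymb i).
Proof. by split; [exact: raddfB | exact: dsymbM]. Qed.

Lemma derivation_mderiv i : derivation (@mderiv N C i).
Proof. by split; [exact: raddfB | exact: mderivM]. Qed.

Lemma derivation_mul P d : derivation d -> derivation (fun S => P * d S).
Proof.
by move=> [db dm]; split=> [S T|S T]; [rewrite db mulrBr | rewrite dm; ring].
Qed.

Lemma derivation_scale c d : derivation d -> derivation (fun S => c *: d S).
Proof.
move=> /(derivation_mul c%:MP); congr derivation; apply/funext => S.
exact: mul_mpolyC.
Qed.

Lemma derivation_add d e : derivation d -> derivation e ->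
  derivation (fun S => d S + e S).
Proof.
by move=> [db dm] [eb em]; split=> S T; [rewrite db eb | rewrite dm em]; ring.
Qed.

Lemma derivation_sub d e : derivation d -> derivation e ->
  derivation (fun S => d S - e S).
Proof.
by move=> [db dm] [eb em]; split=> S T; [rewrite db eb | rewrite dm em]; ring.
Qed.

Lemma derivation_bigsum (I : finType) (d : I -> symb -> symb) :
  (forall a, derivation (d a)) -> derivation (fun S => \sum_a d a S).
Proof.
move=> dd; split=> S T.
  by rewrite -sumrB; apply: eq_bigr => a _; rewrite (dd a).1.
rewrite mulr_suml mulr_sumr -big_split; apply: eq_bigr => a _.
by rewrite (dd a).2.
Qed.

Lemma derivation_bracket d e : derivation d -> derivation e ->
  derivation (fun S => d (e S) - e (d S)).
Proof.
move=> dd ee; split=> S T; first by rewrite ee.1 dd.1 dd.1 ee.1; ring.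
rewrite ee.2 dd.2 (derivationD _ _ dd) (derivationD _ _ ee) !dd.2 !ee.2; ring.
Qed.

(** Functions and fiber coordinates generate the algebra of symbols. Agreement is asked on every
    function, because a derivation of the function ring is not assumed to be a combination of
    partial derivatives. *)
Lemma derivation_ext d e : derivation d -> derivation e ->
  (forall c, d c%:MP = e c%:MP) -> (forall i, d 'X_i = e 'X_i) -> d =1 e.
Proof.
move=> dd ee EC EX S; rewrite [S]mpolyE !(derivation_sum _ _ dd, derivation_sum _ _ ee).
apply: eq_bigr => m _; rewrite -mul_mpolyC dd.2 ee.2 EC; congr (_ + _ * _).
rewrite mpolyXE_id; elim/big_rec: _ => [|i y _ IH].
  by rewrite -mpolyC1.
rewrite dd.2 ee.2 IH; congr (_ * _ + _).
elim: (m i) => [|k IHk]; first by rewrite expr0 -mpolyC1.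
by rewrite exprS dd.2 ee.2 EX IHk.
Qed.

Lemma mcoeffXM i S m :
  ('X_i * S)@_m = if (0 < m i)%N then S@_(m - U_(i))%MM else 0.
Proof.
have [mi|mi] := ltnP; last first.
  rewrite mcoeffM big1 // => -[[k1 /= _] [k2 _]] /= /eqP E.
  rewrite mcoeffX; case: eqP => [E1|_]; last by rewrite mul0r.
  by move: mi; rewrite E mnmDE -E1 mnm1E eqxx.
rewrite mulrC -{1}(@submK _ U_(i) m) ?mcoeffMX //.
  by rewrite addmC mcoeffMX.
by rewrite lep1mP -lt0n.
Qed.

Lemma mcoeff_X_mderiv i S m : ('X_i * mderiv i S)@_m = S@_m *+ m i.
Proof.
rewrite mcoeffXM; case: ltnP => [mi|]; last by rewrite leqn0 => /eqP ->.
rewrite mcoeff_mderiv mnmBE mnm1E eqxx subn1 prednK // submK //.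
by rewrite lep1mP -lt0n.
Qed.

Lemma euler_homog k S : S \is k.-homog -> \sum_i 'X_i * mderiv i S = k%:R *: S.
Proof.
move=> hS; apply/mpolyP => m; rewrite raddf_sum /= mcoeffZ mulr_natl.
under eq_bigr do rewrite mcoeff_X_mderiv.
rewrite sumrMnr -mdegE.
have [->//|/(dhomog_nemf_coeff hS) ->] := eqVneq (mdeg m) k.
by rewrite !mul0rn.
Qed.

(** The part of the Lie derivative that ignores the density weight; it is separated because it is a
    derivation. *)
Definition lie_der (Z : 'rV[C]_N) S : symb :=
  \sum_i Z 0 i *: dsymb i S - \sum_i \sum_j der C j (Z 0 i) *: ('X_i * mderiv j S).

Definition lie (w : R) (Z : 'rV[C]_N) P : symb :=
  \sum_i Z 0 i *: dsymb i P
  - \sum_i \sum_j der C j (Z 0 i) *: ('X_i * mderiv j P)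
  + (scal w * \sum_i der C i (Z 0 i)) *: P.

Lemma lieE (w : R) (Z : 'rV[C]_N) S :
  lie w Z S = lie_der Z S + (scal w * \sum_i der C i (Z 0 i)) *: S.
Proof. by []. Qed.

Lemma derivation_lie_der Z : derivation (lie_der Z).
Proof.
apply: derivation_sub; apply: derivation_bigsum => i.
  exact/derivation_scale/derivation_dsymb.
apply: derivation_bigsum => j.
by apply/derivation_scale/derivation_mul/derivation_mderiv.
Qed.

Lemma lie_derC Z c : lie_der Z c%:MP = (\sum_i Z 0 i * der C i c)%:MP.
Proof.
rewrite /lie_der [X in _ - X]big1 ?subr0 => [|i _]; last first.
  by rewrite big1 // => j _; rewrite mderivC mulr0 scaler0.
by rewrite raddf_sum; apply: eq_bigr => i _ /=; rewrite dsymbC mpolyCM mul_mpolyC.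
Qed.

Lemma mderivXU i j : mderiv i ('X_j : symb) = (i == j)%:R.
Proof.
rewrite mderivX mnm1E eq_sym; case: eqP => [->|_]; last by rewrite scale0r.
rewrite (_ : (U_(j) - U_(j))%MM = 0%MM) ?mpolyX0 ?scale1r //.
by apply/mnmP => l; rewrite mnmBE subnn mnm0E.
Qed.

Lemma lie_derX Z j : lie_der Z 'X_j = - \sum_i (der C j (Z 0 i))%:MP * 'X_i.
Proof.
rewrite /lie_der big1 ?sub0r => [|i _]; last by rewrite dsymbX scaler0.
congr (- _); apply: eq_bigr => i _.
rewrite (bigD1 j) //= mderivXU eqxx mulr1 mul_mpolyC big1 ?addr0 // => l.
by rewrite mderivXU => /negPf ->; rewrite mulr0 scaler0.
Qed.

End SymbolDerivations.

(** * Contact fields, the generalized Hamiltonian and i_alpha *)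

Section ContactOperators.
Variables (R : numFieldType) (n : nat) (C : coord_ring R (cdim n)).
Notation N := (cdim n).
Notation symb := {mpoly C[N]}.
Notation it := (it n).
Implicit Types (h f : C) (S P : symb) (i : 'I_N) (j : 'I_n).

Let p j : C := crd (ip j).
Let q j : C := crd (iq j).
Let d := der C.

Lemma sum_cdim (V : nmodType) (F : 'I_N -> V) :
  \sum_i F i = \sum_j (F (ip j) + F (iq j)) + F it.
Proof.
rewrite big_split_ord big_split_ord /= big_ord1 big_split /=.
by congr (_ + _ + _).
Qed.

Lemma cdim_ind (P : 'I_N -> Prop) :
  (forall j, P (ip j)) -> (forall j, P (iq j)) -> P it -> forall i, P i.
Proof.
move=> Pp Pq Pt i; rewrite -(splitK i); case: (fintype.split i) => k /=; last first.
  by rewrite (ord1 k).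
by rewrite -(splitK k); case: (fintype.split k).
Qed.

Lemma ip_inj j k : (ip j == ip k) = (j == k). Proof. by []. Qed.
Lemma iq_inj j k : (iq j == iq k) = (j == k).
Proof. by rewrite -!val_eqE /= eqn_add2l. Qed.
Lemma ip_iq j k : (ip j == iq k) = false.
Proof. by apply/negbTE; rewrite -val_eqE /= neq_ltn ltn_addr. Qed.
Lemma iq_ip j k : (iq j == ip k) = false.
Proof. by rewrite eq_sym ip_iq. Qed.
Lemma ip_it j : (ip j == it) = false.
Proof. by apply/negbTE; rewrite -val_eqE /= addn0 neq_ltn ltn_addr. Qed.
Lemma iq_it j : (iq j == it) = false.
Proof. by apply/negbTE; rewrite -val_eqE /= addn0 neq_ltn ltn_add2l ltn_ord. Qed.
Lemma it_ip j : (it == ip j) = false. Proof. by rewrite eq_sym ip_it. Qed.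
Lemma it_iq j : (it == iq j) = false. Proof. by rewrite eq_sym iq_it. Qed.
Definition coordE := (ip_inj, iq_inj, ip_iq, iq_ip, ip_it, iq_it, it_ip, it_iq, eqxx).

Definition vfd (i : 'I_N) : 'rV[C]_N := delta_mx 0 i.

Definition euler f : C :=
  \sum_j (p j * d (ip j) f + q j * d (iq j) f).

Definition cfield h : 'rV[C]_N :=
  \sum_j (d (ip j) h *: vfd (iq j) - d (iq j) h *: vfd (ip j))
  + euler h *: vfd it
  - d it h *: (\sum_j (p j *: vfd (ip j) + q j *: vfd (iq j)))
  - (h *+ 2) *: vfd it.

Definition ialph S : symb :=
  scal (2^-1) *:
    (\sum_j (p j *: mderiv (iq j) S - q j *: mderiv (ip j) S)
     - mderiv it S).

Definition eulS S : symb :=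
  \sum_j (p j *: dsymb (ip j) S + q j *: dsymb (iq j) S).

(** The first-order part of X. On a function f it is the symbol of the vector field X_f + 2 f
    d_t. *)
Definition ham_der S : symb :=
  \sum_j ('X_(iq j) * dsymb (ip j) S - 'X_(ip j) * dsymb (iq j) S)
  + 'X_it * eulS S
  - (\sum_j (p j *: 'X_(ip j) + q j *: 'X_(iq j))) * dsymb it S.

Definition gham (w : R) (k : nat) S : symb :=
  \sum_j ('X_(iq j) * dsymb (ip j) S - 'X_(ip j) * dsymb (iq j) S)
  + 'X_it * eulS S
  - (\sum_j (p j *: 'X_(ip j) + q j *: 'X_(iq j))) * dsymb it S
  + scal (2 * n.+1%:R * w - k%:R) *: ('X_it * S).

Lemma ghamE (w : R) (k : nat) S :
  gham w k S = ham_der S + (scal (2 * n.+1%:R * w - k%:R))%:MP * ('X_it * S).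
Proof. by rewrite mul_mpolyC. Qed.

Lemma cfieldE h i :
  cfield h 0 i =
    \sum_j (d (ip j) h * (i == iq j)%:R - d (iq j) h * (i == ip j)%:R)
    + euler h * (i == it)%:R
    - d it h * (\sum_j (p j * (i == ip j)%:R + q j * (i == iq j)%:R))
    - (h *+ 2) * (i == it)%:R.
Proof.
rewrite /cfield !mxE !summxE /=.
congr (_ + _ - d it h * _ - _).
  by apply: eq_bigr => j _; rewrite !mxE.
by apply: eq_bigr => j _; rewrite !mxE.
Qed.

Lemma sum_pick (I : finType) (V : pzSemiRingType) (F : I -> V) (a : I) :
  \sum_b F b * (a == b)%:R = F a.
Proof.
rewrite (bigD1 a) //= eqxx mulr1 big1 ?addr0 // => b ba.
by rewrite eq_sym (negPf ba) mulr0.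
Qed.

Lemma cfield_p h j : cfield h 0 (ip j) = - d (iq j) h - d it h * p j.
Proof.
rewrite cfieldE !coordE /= !mulr0 subr0 addr0.
under eq_bigr do rewrite !coordE /= mulr0 sub0r.
under [X in _ * X]eq_bigr do rewrite !coordE /= mulr0 addr0.
by rewrite sumrN !sum_pick.
Qed.

Lemma cfield_q h j : cfield h 0 (iq j) = d (ip j) h - d it h * q j.
Proof.
rewrite cfieldE !coordE /= !mulr0 subr0 addr0.
under eq_bigr do rewrite !coordE /= mulr0 subr0.
under [X in _ * X]eq_bigr do rewrite !coordE /= mulr0 add0r.
by rewrite !sum_pick.
Qed.

Lemma cfield_t h : cfield h 0 it = euler h - h *+ 2.
Proof.
rewrite cfieldE !coordE /= !mulr1.
rewrite big1 ?add0r => [|j _]; last by rewrite !coordE /= !mulr0 subr0.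
rewrite big1 ?mulr0 ?subr0 // => j _; by rewrite !coordE /= !mulr0 addr0.
Qed.

Lemma der_cfield_p h j i : d i (cfield h 0 (ip j)) =
  - d (iq j) (d i h) - d it (d i h) * p j - d it h * (i == ip j)%:R.
Proof.
rewrite cfield_p raddfB raddfN /= derM der_crd ![der C i (der C _ _)]der_comm.
by rewrite opprD addrA.
Qed.

Lemma der_cfield_q h j i : d i (cfield h 0 (iq j)) =
  d (ip j) (d i h) - d it (d i h) * q j - d it h * (i == iq j)%:R.
Proof.
rewrite cfield_q raddfB /= derM der_crd ![der C i (der C _ _)]der_comm.
by rewrite opprD addrA.
Qed.

Lemma derivation_ham_der : derivation ham_der.
Proof.
apply: derivation_sub; last exact/derivation_mul/derivation_dsymb.
apply: derivation_add; last first.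
  apply/derivation_mul/derivation_bigsum => j.
  by apply: derivation_add; exact/derivation_scale/derivation_dsymb.
apply: derivation_bigsum => j.
by apply: derivation_sub; exact/derivation_mul/derivation_dsymb.
Qed.

Lemma derivation_ialph : derivation ialph.
Proof.
apply: derivation_scale; apply: derivation_sub; last exact: derivation_mderiv.
apply: derivation_bigsum => j.
by apply: derivation_sub; exact/derivation_scale/derivation_mderiv.
Qed.

Definition hsym i : symb := ham_der (crd i)%:MP.

Lemma ham_derC f : ham_der f%:MP =
  \sum_j ((d (ip j) f)%:MP * ('X_(iq j) + (p j)%:MP * 'X_it)
        + (d (iq j) f)%:MP * (- 'X_(ip j) + (q j)%:MP * 'X_it))
  - (d it f)%:MP * \sum_j ((p j)%:MP * 'X_(ip j) + (q j)%:MP * 'X_(iq j)).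
Proof.
rewrite /ham_der /eulS [X in _ + X - _ = _]mulr_sumr -big_split /= dsymbC
  [X in _ - X = _]mulrC.
congr (_ - _ * _); last by apply: eq_bigr => j _; rewrite !mul_mpolyC.
by apply: eq_bigr => j _; rewrite !dsymbC -!mul_mpolyC; ring.
Qed.

Lemma ham_derX m : ham_der 'X_[m] = 0.
Proof.
rewrite /ham_der /eulS dsymbX mulr0 subr0 !big1 ?mulr0 ?addr0 // => j _;
  by rewrite !dsymbX ?mulr0 ?scaler0 ?subr0 ?addr0.
Qed.

Lemma hsym_p j : hsym (ip j) = 'X_(iq j) + (p j)%:MP * 'X_it.
Proof.
rewrite /hsym ham_derC /d der_crd !coordE /= mpolyC0 mul0r subr0.
rewrite (bigD1 j) //= big1 => [|k kj]; rewrite !der_crd !coordE /=.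
  by rewrite mpolyC1 mpolyC0; ring.
by rewrite (negPf kj) mpolyC0; ring.
Qed.

Lemma hsym_q j : hsym (iq j) = - 'X_(ip j) + (q j)%:MP * 'X_it.
Proof.
rewrite /hsym ham_derC /d der_crd !coordE /= mpolyC0 mul0r subr0.
rewrite (bigD1 j) //= big1 => [|k kj]; rewrite !der_crd !coordE /=.
  by rewrite mpolyC1 mpolyC0; ring.
by rewrite (negPf kj) mpolyC0; ring.
Qed.

Lemma hsym_t :
  hsym it = - \sum_j ((p j)%:MP * 'X_(ip j) + (q j)%:MP * 'X_(iq j)).
Proof.
rewrite /hsym ham_derC /d der_crd !coordE /= mpolyC1 mul1r big1 ?sub0r // => j _.
by rewrite !der_crd !coordE /= mpolyC0; ring.
Qed.

Lemma ham_derCE f : ham_der f%:MP = \sum_i (d i f)%:MP * hsym i.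
Proof.
rewrite ham_derC sum_cdim hsym_t mulrN; congr (_ - _).
by apply: eq_bigr => j _; rewrite hsym_p hsym_q.
Qed.

(** The coefficients of [hsym i] are affine in the coordinates, so [ham_der] only replaces each
    coordinate there by its own [hsym]. *)
Lemma ham_der_hsym i : ham_der (hsym i) = 'X_it * hsym i.
Proof.
have dd := derivation_ham_der.
have hE c l : ham_der (c%:MP * 'X_l) = ham_der c%:MP * 'X_l.
  by rewrite dd.2 ham_derX mulr0 addr0.
elim/cdim_ind: i => [j|j|].
- rewrite hsym_p (derivationD _ _ dd) ham_derX hE add0r -/(hsym _) hsym_p; ring.
- rewrite hsym_q (derivationD _ _ dd) (derivationN _ dd) ham_derX hE oppr0 add0r.
  rewrite -/(hsym _) hsym_q; ring.
- rewrite hsym_t (derivationN _ dd) mulrN (derivation_sum _ _ dd) mulr_sumr.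
  congr (- _); apply: eq_bigr => j _.
  rewrite (derivationD _ _ dd) !hE -!/(hsym _) hsym_p hsym_q; ring.
Qed.

Lemma euler_der f i :
  d i (euler f) = euler (d i f) + (i != it)%:R * d i f.
Proof.
rewrite /euler /d raddf_sum /=.
under eq_bigr do rewrite raddfD /= !derM !der_crd ![der C i (der C _ _)]der_comm.
rewrite (eq_bigr (fun j => (p j * der C (ip j) (der C i f) + q j * der C (iq j) (der C i f))
   + ((i == ip j)%:R * der C (ip j) f + (i == iq j)%:R * der C (iq j) f))); last first.
  by move=> j _; rewrite /p /q; ring.
rewrite big_split /=; congr (_ + _).
elim/cdim_ind: i => [j|j|].
- rewrite coordE /= mul1r -[RHS](sum_pick (fun j => der C (ip j) f) j).
  by apply: eq_bigr => k _; rewrite !coordE /=; ring.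
- rewrite coordE /= mul1r -[RHS](sum_pick (fun j => der C (iq j) f) j).
  by apply: eq_bigr => k _; rewrite !coordE /=; ring.
- rewrite coordE /= mul0r big1 // => k _; rewrite !coordE /=; ring.
Qed.

Lemma sum_delta_X i :
  \sum_k ((i == ip k)%:R * 'X_(ip k) + (i == iq k)%:R * 'X_(iq k)) =
  'X_i - (i == it)%:R * 'X_it :> symb.
Proof.
elim/cdim_ind: i => [j|j|]; rewrite !coordE /=.
- rewrite mul0r subr0 -(sum_pick (fun k => 'X_(ip k)) j).
  by apply: eq_bigr => k _; rewrite !coordE /=; ring.
- rewrite mul0r subr0 -(sum_pick (fun k => 'X_(iq k)) j).
  by apply: eq_bigr => k _; rewrite !coordE /=; ring.
- by rewrite mul1r subrr big1 // => k _; rewrite !coordE /=; ring.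
Qed.

(* The atoms are generalized because [ring] compares them up to conversion. *)
Ltac mring := repeat match goal with
  | |- context [ham_der ?S] => generalize (ham_der S)
  | |- context [lie_der ?Z ?S] => generalize (lie_der Z S)
  | |- context [hsym ?i] => generalize (hsym i)
  | |- context [ialph ?S] => generalize (ialph S)
  | |- context [@mderiv ?m ?A ?i ?S] => generalize (@mderiv m A i S)
  | |- context [@mpolyX ?m ?A ?a] => generalize (@mpolyX m A a)
  | |- context [@mpolyC ?m ?A ?a] => generalize (@mpolyC m A a)
  end; intros; ring.

(** All second derivatives of h are absorbed into [ham_der] of d_i h, so the later brackets are
    computed without returning to the components of X_h. *)
Lemma lie_derX_cfield h i :
  lie_der (cfield h) 'X_i =
  - ham_der (d i h)%:MP + (d it h)%:MP * 'X_i + (d i h)%:MP * 'X_it.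
Proof.
rewrite lie_derX sum_cdim cfield_t ham_derC.
have -> : der C i (euler h - h *+ 2) =
    \sum_j (p j * d (ip j) (d i h) + q j * d (iq j) (d i h))
    + ((i != it)%:R - 2) * d i h.
  by rewrite raddfB raddfMn /= -/d euler_der /euler; ring.
rewrite (eq_bigr (fun j => ((d (ip j) (d i h))%:MP * 'X_(iq j)
    - (d (iq j) (d i h))%:MP * 'X_(ip j)
    - (d it (d i h))%:MP * ((p j)%:MP * 'X_(ip j) + (q j)%:MP * 'X_(iq j)))
    - (d it h)%:MP *
      ((i == ip j)%:R * 'X_(ip j) + (i == iq j)%:R * 'X_(iq j)))); last first.
  by move=> j _; rewrite der_cfield_p der_cfield_q !(mpolyCB, mpolyCN, mpolyCM)
       !mpolyC_nat; ring.
rewrite sumrB -mulr_sumr sum_delta_X sumrB -mulr_sumr.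
rewrite [X in _ = - (X - _) + _ + _](eq_bigr (fun j =>
    ((d (ip j) (d i h))%:MP * 'X_(iq j) - (d (iq j) (d i h))%:MP * 'X_(ip j)) + 
    ((p j * d (ip j) (d i h) + q j * d (iq j) (d i h))%:MP * 'X_it))); last first.
  by move=> j _; rewrite mpolyCD !mpolyCM; ring.
rewrite [in RHS]big_split /= -mulr_suml -raddf_sum /=.
rewrite mpolyCD mpolyCM mpolyCB !mpolyC_nat.
by case: eqVneq => [->|_] /=; ring.
Qed.

(** The partial derivatives of f are killed by [ham_der], which leaves [ham_der_hsym]. It is applied
    to the first derivatives of a quadratic h. *)
Lemma ham_der_affine f : (forall i l, d i (d l f) = 0) ->
  ham_der (ham_der f%:MP) = 'X_it * ham_der f%:MP.
Proof.
move=> f2; have dd := derivation_ham_der.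
rewrite [in LHS]ham_derCE ham_derCE (derivation_sum _ _ dd) mulr_sumr.
apply: eq_bigr => i _; rewrite dd.2 ham_der_hsym ham_derCE big1 => [|l _].
  by ring.
by rewrite f2 mul0r.
Qed.

(** This holds for every h: second derivatives of h enter both sides only inside [ham_der] of first
    derivatives, where they match. *)
Lemma lie_der_hsym h i :
  lie_der (cfield h) (hsym i) =
  ham_der (cfield h 0 i)%:MP + (d it h)%:MP * hsym i *+ 2.
Proof.
have dl := derivation_lie_der (cfield h); have dh := derivation_ham_der.
have lx l : lie_der (cfield h) (crd l)%:MP = (cfield h 0 l)%:MP.
  rewrite lie_derC -[in RHS](sum_pick (fun k => cfield h 0 k) l); congr (_%:MP).
  by apply: eq_bigr => k _; rewrite der_crd eq_sym.
elim/cdim_ind: i => [j|j|].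
- rewrite hsym_p (derivationD _ _ dl) dl.2 lx !lie_derX_cfield cfield_p.
  rewrite mpolyCB mpolyCN mpolyCM dh.1 (derivationN _ dh) dh.2 -/(hsym _) hsym_p; mring.
- rewrite hsym_q (derivationD _ _ dl) (derivationN _ dl) dl.2 lx !lie_derX_cfield cfield_q.
  rewrite mpolyCB mpolyCM dh.1 dh.2 -/(hsym _) hsym_q; mring.
- have twoE : ham_der (h *+ 2)%:MP = ham_der h%:MP *+ 2.
    by rewrite mpolyCMn !mulr2n (derivationD _ _ dh).
  rewrite hsym_t (derivationN _ dl) (derivation_sum _ _ dl) cfield_t.
  rewrite mpolyCB dh.1 twoE [ham_der h%:MP]ham_derCE sum_cdim hsym_t.
  rewrite /euler (raddf_sum (@mpolyC N C)) /= (derivation_sum _ _ dh).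
  set S := \sum_(_ < n) (_ * 'X_(ip _) + _).
  rewrite [RHS](_ : _ = \sum_(j < n) ham_der (p j * d (ip j) h + q j * d (iq j) h)%:MP
    - (\sum_(j < n) ((d (ip j) h)%:MP * hsym (ip j) + (d (iq j) h)%:MP * hsym (iq j))) *+ 2);
    last by mring.
  rewrite -sumrMnl -sumrB -[LHS]sumrN; apply: eq_bigr => j _.
  rewrite (derivationD _ _ dl) !dl.2 !lx !lie_derX_cfield cfield_p cfield_q.
  rewrite !(mpolyCB, mpolyCD, mpolyCN, mpolyCM) (derivationD _ _ dh) !dh.2.
  rewrite -!/(hsym _) hsym_p hsym_q; mring.
Qed.

(** Both sides are derivations in S. The last term, an Euler operator, is zero on functions and
    comes from the fiber coordinates alone. *)
Lemma lie_ham_bracket h S : (forall i l k, d i (d l (d k h)) = 0) ->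
  lie_der (cfield h) (ham_der S) - ham_der (lie_der (cfield h) S) =
  (d it h)%:MP * ham_der S *+ 2
  - ham_der (d it h)%:MP * \sum_i 'X_i * mderiv i S.
Proof.
move=> h3; have dl := derivation_lie_der (cfield h); have dh := derivation_ham_der.
have comm2 f : lie_der (cfield h) (ham_der f%:MP) - ham_der (lie_der (cfield h) f%:MP)
    = (d it h)%:MP * ham_der f%:MP *+ 2.
  rewrite lie_derC [in X in X - _]ham_derCE raddf_sum /=.
  rewrite (derivation_sum _ _ dl) (derivation_sum _ _ dh) [in RHS]ham_derCE.
  under eq_bigr do rewrite dl.2 lie_der_hsym lie_derC raddf_sum mulr_suml /=.
  under [X in _ - X]eq_bigr do rewrite mpolyCM dh.2 [ham_der (d _ _)%:MP]ham_derCE mulr_sumr.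
  (* After this exchange of sums the terms with second derivatives of f cancel, by symmetry of mixed
     derivatives. *)
  rewrite !big_split /= [X in _ - (_ + X)]exchange_big /=.
  rewrite [X in _ - (_ + X)](_ : _ = \sum_(i < N) \sum_(i0 < N)
     (cfield h 0 i0 * d i0 (d i f))%:MP * hsym i); last first.
    apply: eq_bigr => i _; apply: eq_bigr => l _.
    by rewrite mpolyCM /d der_comm; mring.
  rewrite addrC opprD addrACA [_ - _ in X in _ + X]subrr addr0 -sumrB mulr_sumr -sumrMnl.
  by apply: eq_bigr => i _; rewrite /d; mring.
move: S; apply: derivation_ext => [||f|i].
- exact: derivation_bracket.
- apply: derivation_sub.
    rewrite (_ : (fun S => _) = (fun S => ((d it h)%:MP *+ 2) * ham_der S)).
      exact: derivation_mul.
    by apply/funext => S; mring.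
  apply/derivation_mul/derivation_bigsum => i.
  exact/derivation_mul/derivation_mderiv.
- rewrite comm2 big1 ?mulr0 ?subr0 // => i _.
  by rewrite mderivC mulr0.
- rewrite !ham_derX (derivation0 dl) mulr0 mul0rn !sub0r; congr (- _).
  rewrite lie_derX_cfield !(derivationD _ _ dh) (derivationN _ dh) !dh.2 !ham_derX.
  (* The vanishing of the third derivatives of h enters here: d_i h is affine. *)
  rewrite ham_der_affine; last by move=> *; exact: h3.
  rewrite (bigD1 i) //= mderivXU eqxx big1 ?addr0 => [|l li].
    by rewrite /=; mring.
  by rewrite mderivXU (negPf li) mulr0.
Qed.

Lemma div_cfield h : \sum_i d i (cfield h 0 i) = - (2 * n.+1%:R) * d it h.
Proof.
rewrite sum_cdim cfield_t /d raddfB raddfMn /= -/d euler_der eqxx mul0r addr0.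
under eq_bigr do rewrite der_cfield_p der_cfield_q !eqxx !mulr1
  [d (ip _) (d (iq _) h)]der_comm.
rewrite (eq_bigr (fun j => - (p j * d (ip j) (d it h) + q j * d (iq j) (d it h))
   - d it h *+ 2)); last first.
  by move=> j _; rewrite /d ![der C it (der C _ _)]der_comm; ring.
rewrite sumrB sumrN sumr_const card_ord -/(euler (d it h)) -addn1 natrD -(mulr_natr _ n); ring.
Qed.

Lemma scal_div_cfield h (w : R) : scal w * \sum_i der C i (cfield h 0 i) =
  - (scal (2 * n.+1%:R * w) * d it h).
Proof. by rewrite div_cfield !rmorphM !rmorph_nat; ring. Qed.

Lemma symbCM f g : (f * g)%:MP = f%:MP * g%:MP :> symb.
Proof. exact: mpolyCM. Qed.

Lemma symbCN f : (- f)%:MP = - f%:MP :> symb.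
Proof. exact: mpolyCN. Qed.

Lemma scal_shift h (w : R) :
  (scal (2 * n.+1%:R * (w + n.+1%:R^-1)) * d it h)%:MP =
  ((scal (2 * n.+1%:R * w))%:MP + 2) * (d it h)%:MP :> symb.
Proof.
rewrite mulrDr mulfK ?pnatr_eq0 // rmorphD (rmorph_nat (@scal R _ C)).
by rewrite mpolyCM mpolyCD mpolyC_nat.
Qed.

Lemma scal_subn (a : R) (k : nat) : (scal (a - k%:R))%:MP = (scal a)%:MP - k%:R :> symb.
Proof. by rewrite rmorphB (rmorph_nat (@scal R _ C)) mpolyCB mpolyC_nat. Qed.

(** The terms in [ham_der] of d_t h fix the constant c of X: the Euler term of the bracket gives -k,
    the action on xi_t gives -c, and differentiating the divergence gives -2(n+1)w on the other
    side, so c = 2(n+1)w - k. *)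
Lemma lie_gham h (w : R) (k : nat) S : (forall i l m, d i (d l (d m h)) = 0) ->
  S \is k.-homog ->
  lie (w + n.+1%:R^-1) (cfield h) (gham w k S) = gham w k (lie w (cfield h) S).
Proof.
move=> h3 hS; have dl := derivation_lie_der (cfield h); have dh := derivation_ham_der.
rewrite !lieE !scal_div_cfield !ghamE -!mul_mpolyC (derivationD _ _ dl).
rewrite !dl.2 lie_derX_cfield (derivationD _ _ dh) !dh.2.
have scal0 a : lie_der (cfield h) (scal a)%:MP = 0 /\ ham_der (scal a)%:MP = 0.
  rewrite lie_derC ham_derCE !big1 ?mpolyC0 // => i _; rewrite /d der_scalar ?mpolyC0;
  by rewrite ?mul0r ?mulr0.
rewrite !symbCN (derivationN _ dh) scal_shift !symbCM dh.2.
rewrite (scal0 _).1 (scal0 _).2.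
have := lie_ham_bracket S h3; rewrite (euler_homog hS) -mul_mpolyC.
move/eqP; rewrite subr_eq => /eqP ->.
rewrite ?scal_subn ?mpolyC_nat; mring.
Qed.

Lemma ialph_C f : ialph f%:MP = 0.
Proof.
rewrite /ialph mderivC subr0 big1 ?scaler0 // => j _.
by rewrite !mderivC !scaler0 subrr.
Qed.

Definition alpha i : C :=
  scal (2^-1) * (\sum_j (p j * (i == iq j)%:R - q j * (i == ip j)%:R) - (i == it)%:R).

Lemma ialph_X i : ialph 'X_i = (alpha i)%:MP.
Proof.
rewrite /ialph /alpha mpolyCM mul_mpolyC; congr (_ *: _).
rewrite mpolyCB mpolyC_nat mderivXU eq_sym raddf_sum /=; congr (_ - _).
apply: eq_bigr => j _; rewrite !mderivXU mpolyCB !mpolyCM !mpolyC_nat !mul_mpolyC.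
by rewrite !(eq_sym i).
Qed.

Lemma alpha_p j : alpha (ip j) = - scal (2^-1) * q j.
Proof.
rewrite /alpha coordE /= subr0; under eq_bigr do rewrite !coordE /= mulr0 sub0r.
by rewrite sumrN sum_pick mulrN mulNr.
Qed.

Lemma alpha_q j : alpha (iq j) = scal (2^-1) * p j.
Proof.
rewrite /alpha coordE /= subr0; under eq_bigr do rewrite !coordE /= mulr0 subr0.
by rewrite sum_pick.
Qed.

Lemma alpha_t : alpha it = - scal (2^-1).
Proof.
rewrite /alpha eqxx big1 => [|k _]; last by rewrite !coordE /= !mulr0 subrr.
by rewrite sub0r mulrN1.
Qed.

(** Each [hsym i] is the symbol of a field in the kernel of the contact form. *)
Lemma ialph_ham f : ialph (ham_der f%:MP) = 0.
Proof.
have di := derivation_ialph.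
rewrite ham_derCE (derivation_sum _ _ di) big1 // => i _.
rewrite di.2 ialph_C mul0r add0r [X in _ * X](_ : _ = 0) ?mulr0 //.
elim/cdim_ind: i => [j|j|].
- rewrite hsym_p (derivationD _ _ di) di.2 ialph_C !ialph_X alpha_q alpha_t.
  by rewrite mpolyCM mpolyCN; mring.
- rewrite hsym_q (derivationD _ _ di) (derivationN _ di) di.2 ialph_C !ialph_X.
  by rewrite alpha_p alpha_t mpolyCM !mpolyCN; mring.
- rewrite hsym_t (derivationN _ di) (derivation_sum _ _ di) big1 ?oppr0 // => j _.
  rewrite (derivationD _ _ di) !di.2 !ialph_C !ialph_X alpha_p alpha_q.
  by rewrite !mpolyCM mpolyCN; mring.
Qed.

(** This expresses that X_h is a contact field: it preserves the contact form up to a multiple of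
    d_t h. In contrast to [lie_ham_bracket], it holds for every h. *)
Lemma lie_ialph_bracket h S :
  lie_der (cfield h) (ialph S) - ialph (lie_der (cfield h) S) =
  (- (d it h)%:MP *+ 2) * ialph S.
Proof.
have dl := derivation_lie_der (cfield h); have di := derivation_ialph.
move: S; apply: derivation_ext => [||f|i].
- exact: derivation_bracket.
- exact: derivation_mul.
- by rewrite lie_derC !ialph_C (derivation0 dl) mulr0 subrr.
rewrite lie_derX_cfield !(derivationD _ _ di) (derivationN _ di) ialph_ham oppr0 add0r.
rewrite !di.2 !ialph_C !mul0r !add0r !ialph_X lie_derC -!mpolyCM.
rewrite -mpolyCD -mpolyCB -mpolyCN -mpolyCMn -mpolyCM; congr (_%:MP).
have half : scal (2^-1) *+ 2 = 1 :> C.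
  by rewrite -mulr_natr -(rmorph_nat (@scal R _ C)) -rmorphM mulVf ?rmorph1 ?pnatr_eq0.
have dhalf l g : der C l (scal (2^-1) * g) = scal (2^-1) * der C l g.
  by rewrite derM der_scalar mul0r add0r.
elim/cdim_ind: i => [j|j|].
- under eq_bigr do rewrite alpha_p mulNr raddfN /= dhalf der_crd eq_sym mulrN mulrA.
  rewrite sumrN sum_pick cfield_q alpha_p alpha_t /=.
  by ring: half.
- under eq_bigr do rewrite alpha_q dhalf der_crd eq_sym mulrA.
  rewrite sum_pick cfield_p alpha_q alpha_t /=.
  by ring: half.
- rewrite big1 => [|l _]; last by rewrite alpha_t raddfN /= der_scalar oppr0 mulr0.
  rewrite alpha_t /=; by ring: half.
Qed.

Lemma lie_ialph h (w : R) S :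
  lie w (cfield h) (ialph S) = ialph (lie (w + n.+1%:R^-1) (cfield h) S).
Proof.
have dl := derivation_lie_der (cfield h); have di := derivation_ialph.
rewrite !lieE !scal_div_cfield -!mul_mpolyC (derivationD _ _ di) di.2 ialph_C mul0r add0r.
have := lie_ialph_bracket h S; move/eqP; rewrite subr_eq => /eqP ->.
rewrite !symbCN scal_shift !symbCM; mring.
Qed.

End ContactOperators.

(** * Differential operators and the invariance of the generators *)

Section DifferentialOperators.
Variables (R : numFieldType) (N : nat) (C : coord_ring R N).
Notation symb := {mpoly C[N]}.
Implicit Types (f g : C) (S P : symb) (D : symb -> symb) (i j : 'I_N) (k l : nat)
  (b m : 'X_{1..N}).

Lemma homog_coefP k S :
  (forall m, mdeg m != k -> S@_m = 0) <-> S \is k.-homog.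
Proof.
split=> [S0|hS m]; last exact: dhomog_nemf_coeff.
apply/dhomogP => m; rewrite mcoeff_msupp; apply: contraNeq.
by move/S0 => ->.
Qed.

Lemma homog_dsymb k S i : S \is k.-homog -> dsymb i S \is k.-homog.
Proof.
move=> /homog_coefP hS; apply/homog_coefP => m mk.
by rewrite mcoeff_dsymb hS // raddf0.
Qed.

Lemma homog_mderiv k S i : S \is k.-homog -> mderiv i S \is k.-1.-homog.
Proof.
move=> /homog_coefP hS; apply/homog_coefP => m mk.
rewrite mcoeff_mderiv hS ?mul0rn // mdegD mdeg1 addn1.
by apply: contra mk => /eqP <-.
Qed.

Lemma homogXM k S i : S \is k.-homog -> 'X_i * S \is k.+1.-homog.
Proof. by move=> hS; rewrite -add1n; apply: dhomogM => //; rewrite dhomogX /= mdeg1. Qed.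

Lemma homog_Xmderiv k S i j : S \is k.-homog -> 'X_i * mderiv j S \is k.-homog.
Proof.
case: k => [|k] hS; last exact/homogXM/(homog_mderiv j hS).
rewrite (_ : mderiv j S = 0) ?mulr0 ?rpred0 //.
apply/mpolyP => m; rewrite mcoeff_mderiv mcoeff0 (dhomog_nemf_coeff hS) ?mul0rn //=.
by rewrite mdegD mdeg1 addn1.
Qed.

Lemma homog_lie (w : R) Z k S : S \is k.-homog -> lie w Z S \is k.-homog.
Proof.
move=> hS; rewrite /lie; apply: rpredD; last exact: dhomogZ.
apply: rpredB; apply: rpred_sum => i _; first exact/dhomogZ/homog_dsymb.
by apply: rpred_sum => j _; exact/dhomogZ/homog_Xmderiv.
Qed.

Definition dmulti b f : C :=
  foldr (fun i g => iter (b i) (der C i) g) f (enum 'I_N).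

Lemma dmulti0 f : dmulti 0%MM f = f.
Proof.
rewrite /dmulti; elim: (enum _) => //= i s ->.
by rewrite mnm0E.
Qed.

Lemma der_iter i j c f : der C i (iter c (der C j) f) = iter c (der C j) (der C i f).
Proof. by elim: c => //= c <-; rewrite der_comm. Qed.

Lemma dmultiS i b f : dmulti (U_(i) + b) f = der C i (dmulti b f).
Proof.
rewrite /dmulti.
have : i \in enum 'I_N by rewrite mem_enum.
elim: (enum _) (enum_uniq 'I_N) => //= j s IH /andP[js us].
rewrite inE mnmDE mnm1E; case: (eqVneq i j) => [ij|ij] /=.
  rewrite -{j}ij in js * => _; congr (der C i (iter _ _ _)).
  elim: s js {us IH} => //= k s IH; rewrite inE negb_or => /andP[ik /IH ->].
  by rewrite mnmDE mnm1E (negPf ik).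
by move=> /(IH us) ->; rewrite der_iter.
Qed.

Lemma dmulti_is_additive b : zmod_morphism (dmulti b).
Proof.
move=> f g; rewrite /dmulti; elim: (enum _) => //= i s ->.
by elim: (b i) => //= c ->; rewrite raddfB.
Qed.
HB.instance Definition _ b :=
  GRing.isZmodMorphism.Build C C (dmulti b) (dmulti_is_additive b).

(** A finite list of terms (derivative, coefficient index, symbol) replaces the double sum over
    bounded multi-indices: concatenating and mapping lists makes closure under the operations
    immediate. *)
Definition dop l D := exists s : seq ('X_{1..N} * 'X_{1..N} * symb),
  forall S, S \is l.-homog -> D S = \sum_(t <- s) dmulti t.1.1 S@_t.1.2 *: t.2.

Lemma dop_ext l D D' : (forall S, S \is l.-homog -> D' S = D S) -> dop l D -> dop l D'.
Proof. by move=> E [s sE]; exists s => S hS; rewrite E // sE. Qed.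

Lemma dop_id l : dop l id.
Proof.
exists [seq (0%MM, bmnm a, 'X_[a]) | a <- index_enum 'X_{1..N < l.+1}] => S hS.
rewrite big_map /= {1}[S](@mpolywE _ _ l.+1).
  by apply: eq_bigr => m _; rewrite dmulti0.
rewrite msizeE; apply/bigmax_leqP_seq => m mS _.
by rewrite (dhomog_mf hS mS).
Qed.

Lemma dop_add l D E : dop l D -> dop l E -> dop l (fun S => D S + E S).
Proof. by move=> [s sE] [t tE]; exists (s ++ t) => S hS; rewrite big_cat sE ?tE. Qed.

Lemma dop_mul l D P : dop l D -> dop l (fun S => P * D S).
Proof.
move=> [s sE]; exists [seq (t.1, P * t.2) | t <- s] => S hS.
by rewrite big_map sE // mulr_sumr; apply: eq_bigr => t _; rewrite scalerAr.
Qed.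

Lemma dop_scale l D c : dop l D -> dop l (fun S => c *: D S).
Proof.
by move/(@dop_mul _ _ c%:MP); apply: dop_ext => S _; rewrite mul_mpolyC.
Qed.

Lemma dop_sub l D E : dop l D -> dop l E -> dop l (fun S => D S - E S).
Proof.
move=> hD hE; apply: dop_ext (dop_add hD (dop_scale (-1) hE)) => S _.
by rewrite scaleN1r.
Qed.

Lemma dop_bigsum l (I : Type) (r : seq I) (D : I -> symb -> symb) :
  (forall a, dop l (D a)) -> dop l (fun S => \sum_(a <- r) D a S).
Proof.
move=> hD; elim: r => [|a r IH].
  by exists [::] => S _; rewrite !big_nil.
by apply: dop_ext (dop_add (hD a) IH) => S _; rewrite big_cons.
Qed.

Lemma dop_dsymb l D i : dop l D -> dop l (fun S => dsymb i (D S)).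
Proof.
move=> [s sE].
exists ([seq ((U_(i) + t.1.1)%MM, t.1.2, t.2) | t <- s]
     ++ [seq (t.1, dsymb i t.2) | t <- s]) => S hS.
rewrite sE // big_cat !big_map /= raddf_sum -big_split; apply: eq_bigr => t _.
by rewrite /= dsymbZ dmultiS.
Qed.

Lemma dop_mderiv l D i : dop l D -> dop l (fun S => mderiv i (D S)).
Proof.
move=> [s sE]; exists [seq (t.1, mderiv i t.2) | t <- s] => S hS.
by rewrite sE // big_map raddf_sum; apply: eq_bigr => t _; rewrite /= mderivZ.
Qed.

Definition diff_op l k D : Prop :=
  (forall S, S \is l.-homog -> D S \is k.-homog) /\
  exists (r : nat) (A : 'X_{1..N} -> 'X_{1..N} -> symb),
    forall S, S \is l.-homog ->
      D S = \sum_(beta : 'X_{1..N < r.+1}) \sum_(m : 'X_{1..N < l.+1})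
              dmulti beta S@_m *: A beta m.

Lemma diff_op_dop l k D : diff_op l k D -> dop l D.
Proof.
case=> _ [r [A DE]].
exists [seq (bmnm a, bmnm a', A a a') | a <- index_enum 'X_{1..N < r.+1},
                                        a' <- index_enum 'X_{1..N < l.+1}] => S hS.
by rewrite DE // big_allpairs_dep.
Qed.

Lemma dop_diff_op l k D : (forall S, S \is l.-homog -> D S \is k.-homog) ->
  dop l D -> diff_op l k D.
Proof.
move=> hD [s sE]; split=> //.
have [r] : exists r, all (fun t => mdeg t.1.1 <= r)%N s.
  exists (\max_(t <- s) mdeg t.1.1); apply/allP => t ts.
  by rewrite (big_rem t) //= leq_maxl.
suff H : all (fun t => mdeg t.1.1 <= r)%N s -> exists A, forall S, S \is l.-homog ->
    \sum_(t <- s) dmulti t.1.1 S@_t.1.2 *: t.2 =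
    \sum_(beta : 'X_{1..N < r.+1}) \sum_(m : 'X_{1..N < l.+1})
              dmulti beta S@_m *: A (bmnm beta) (bmnm m).
  by case/H => A AE; exists r, A => S hS; rewrite sE // AE.
elim: s {sE} => [_|[[b m] P] s IH /= /andP[br /IH [A AE]]].
  exists (fun _ _ => 0) => S _; rewrite big_nil big1 // => b _.
  by rewrite big1 // => m _; rewrite scaler0.
exists (fun b' m' => A b' m' + if (b' == b) && (m' == m) then P else 0) => S hS.
rewrite big_cons {}AE //=.
under [RHS]eq_bigr do (under eq_bigr do rewrite scalerDr); rewrite /=.
under [RHS]eq_bigr do rewrite big_split; rewrite big_split /= addrC; congr (_ + _).
have br' : (mdeg b < r.+1)%N by [].
rewrite (bigD1 (BMultinom br')) //= [X in _ = _ + X]big1 ?addr0 => [|b' b'b]; last first.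
  rewrite big1 // => m' _; rewrite ifF ?scaler0 //.
  by apply/negbTE; rewrite negb_and -val_eqE /= in b'b *; rewrite b'b.
have [ml|ml] := leqP (mdeg m) l; last first.
  (* An index of degree above l lies outside the double sum, but its term is zero on l-homogeneous
     S. *)
  rewrite (dhomog_nemf_coeff hS) ?raddf0 ?scale0r; last by rewrite /= gtn_eqF.
  rewrite big1 // => m' _; rewrite ifF ?scaler0 // eqxx /=; apply: contraTF ml => /eqP <-.
  by rewrite -leqNgt -ltnS bmdeg.
have ml' : (mdeg m < l.+1)%N by [].
rewrite (bigD1 (BMultinom ml')) //= !eqxx big1 ?addr0 // => m' m'm.
by rewrite -val_eqE /= in m'm; rewrite (negPf m'm) scaler0.
Qed.

End DifferentialOperators.

Section GeneratorDefinitions.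
Variables (R : numFieldType) (n : nat) (C : coord_ring R (cdim n)).
Notation symb := {mpoly C[cdim n]}.
Implicit Types (delta : R) (S : symb) (k l m : nat).

Definition rweight delta k : R := delta + k%:R / n.+1%:R.

Definition xham delta k S : symb := gham (rweight delta k) k S.

Fixpoint xpow delta k m S : symb :=
  if m is m'.+1 then xham delta (k + m') (xpow delta k m' S) else S.

Definition gen delta l k m S : symb :=
  xpow delta (k - m) m (iter (l + m - k) (@ialph R n C) S).

End GeneratorDefinitions.

Section Generators.
Variables (R : numFieldType) (n : nat) (C : coord_ring R (cdim n)) (delta : R).
Notation symb := {mpoly C[cdim n]}.
Notation rweight := (rweight n delta).
Notation xpow := (@xpow R n C delta).
Notation gen := (@gen R n C delta).
Implicit Types (h : C) (S : symb) (k l m r : nat).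

Lemma rweightS k : rweight k.+1 = rweight k + n.+1%:R^-1.
Proof. by rewrite /rweight -addn1 natrD mulrDl mul1r addrA. Qed.

Lemma homog_ialph k S : S \is k.-homog -> ialph S \is k.-1.-homog.
Proof.
move=> hS; apply/dhomogZ/rpredB; last exact: homog_mderiv.
by apply: rpred_sum => j _; apply: rpredB; exact/dhomogZ/homog_mderiv.
Qed.

Lemma homog_gham (w : R) k S : S \is k.-homog -> gham w k S \is k.+1.-homog.
Proof.
move=> hS; rewrite /gham; apply: rpredD; last exact/dhomogZ/homogXM.
apply: rpredB; first apply: rpredD.
- by apply: rpred_sum => j _; apply: rpredB; exact/homogXM/homog_dsymb.
- apply: homogXM; apply: rpred_sum => j _.
  by apply: rpredD; exact/dhomogZ/homog_dsymb.
- rewrite -add1n; apply: dhomogM; last exact: homog_dsymb.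
  by apply: rpred_sum => j _; apply: rpredD; apply: dhomogZ; rewrite dhomogX /= mdeg1.
Qed.

Lemma homog_iter_ialph r l S : S \is l.-homog ->
  iter r (@ialph R n C) S \is (l - r).-homog.
Proof.
by move=> hS; elim: r => [|r IH]; rewrite ?subn0 // subnS; exact: homog_ialph.
Qed.

Lemma homog_xpow k m S : S \is k.-homog -> xpow k m S \is (k + m).-homog.
Proof.
by move=> hS; elim: m => [|m IH]; rewrite ?addn0 // addnS; exact: homog_gham.
Qed.

Lemma gen_degree k l m : (k <= l + m)%N -> (m <= k)%N -> (l - (l + m - k) = k - m)%N.
Proof. by move=> *; lia. Qed.

Lemma homog_gen k l m S : (k <= l + m)%N -> (m <= k)%N -> S \is l.-homog ->
  gen l k m S \is k.-homog.
Proof.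
move=> klm mk hS; rewrite -{2}(subnK mk); apply: homog_xpow.
by rewrite -(gen_degree klm mk); exact: homog_iter_ialph.
Qed.

Lemma dop_ialph l D : dop l D -> dop l (fun S => ialph (D S)).
Proof.
move=> hD; apply/dop_scale/dop_sub; last exact: dop_mderiv.
by apply: dop_bigsum => j; apply: dop_sub; exact/dop_scale/dop_mderiv.
Qed.

Lemma dop_gham (w : R) k l D : dop l D -> dop l (fun S => gham w k (D S)).
Proof.
move=> hD; apply: dop_add; last exact/dop_scale/dop_mul.
apply: dop_sub; last exact/dop_mul/dop_dsymb.
apply: dop_add; first by apply: dop_bigsum => j; apply: dop_sub; exact/dop_mul/dop_dsymb.
by apply/dop_mul/dop_bigsum => j; apply: dop_add; exact/dop_scale/dop_dsymb.
Qed.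

Lemma dop_gen k l m : dop l (gen l k m).
Proof.
rewrite /gen; elim: (l + m - k)%N => [|r IHr] /=; last first.
  have xi r' : dop l (fun S => iter r' (@ialph R n C) S).
    by elim: r' => [|r' IH]; [exact: dop_id | exact: dop_ialph].
  by elim: m {IHr} (k - m)%N => [|m IH] k' /=; [exact: (xi r.+1) | exact/dop_gham/IH].
elim: m (k - m)%N => [|m IH] k' /=; first exact: dop_id.
exact/dop_gham/IH.
Qed.

Definition poly_deg2 h : Prop :=
  exists Q : {mpoly R[cdim n]},
    (msize Q <= 3)%N /\ forall x : 'rV[R]_(cdim n), evc C x h = Q.@[fun i => x 0 i].

Definition sp_field (Z : 'rV[C]_(cdim n)) : Prop :=
  exists h, poly_deg2 h /\ Z = cfield h.

Definition sp_inv l k (D : symb -> symb) : Prop :=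
  forall Z, sp_field Z -> forall S, S \is l.-homog ->
    lie (rweight k) Z (D S) = D (lie (rweight l) Z S).

Lemma lie_iter_ialph h r l S : (r <= l)%N ->
  lie (rweight (l - r)) (cfield h) (iter r (@ialph R n C) S) =
  iter r (@ialph R n C) (lie (rweight l) (cfield h) S).
Proof.
elim: r => [|r IH] rl; rewrite ?subn0 //= lie_ialph -rweightS.
by rewrite -subSn // subSS IH // ltnW.
Qed.

Lemma lie_xpow h k m S :
  (forall i j e, der C i (der C j (der C e h)) = 0) -> S \is k.-homog ->
  lie (rweight (k + m)) (cfield h) (xpow k m S) =
  xpow k m (lie (rweight k) (cfield h) S).
Proof.
move=> h3 hS; elim: m => [|m IH] /=; rewrite ?addn0 // addnS rweightS.
by rewrite lie_gham ?IH //; exact: homog_xpow.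
Qed.

Lemma lie_gen h k l m S : (forall i j e, der C i (der C j (der C e h)) = 0) ->
  (k <= l + m)%N -> (m <= k)%N -> S \is l.-homog ->
  lie (rweight k) (cfield h) (gen l k m S) = gen l k m (lie (rweight l) (cfield h) S).
Proof.
move=> h3 klm mk hS; rewrite /gen -{1}(subnK mk) lie_xpow //; last first.
  by rewrite -(gen_degree klm mk); exact: homog_iter_ialph.
by congr (xpow _ _ _); rewrite -(gen_degree klm mk) lie_iter_ialph //; lia.
Qed.

End Generators.

(** * Polynomial functions and their derivatives *)

Section Polynomials.
Variables (R : numFieldType) (N : nat) (C : coord_ring R N).
Implicit Types (f g : C) (i j : 'I_N) (m b : 'X_{1..N}) (Q : {mpoly R[N]}).

Lemma der_exp i f k : der C i (f ^+ k) = k%:R * f ^+ k.-1 * der C i f.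
Proof.
elim: k => [|k IH]; first by rewrite expr0 !mul0r -(rmorph1 (@scal R N C)) der_scalar.
rewrite exprS derM IH; case: k {IH} => [|k]; first by rewrite expr0; ring.
by rewrite /= exprS -[k.+2%:R]natr1; ring.
Qed.

(** The functions h are left general to cover both the coordinates and the coordinates centred at a
    point, which Taylor polynomials need. *)
Lemma der_monomial (h : 'I_N -> C) i m :
  (forall j, der C i (h j) = (i == j)%:R) ->
  der C i (mmap1 h m) = (m i)%:R * mmap1 h (m - U_(i))%MM.
Proof.
move=> dh; rewrite /mmap1 (bigD1 i) //= [in RHS](bigD1 i) //= derM der_exp dh eqxx.
rewrite mnmBE mnm1E eqxx subn1 mulr1 mulrA.
rewrite [in RHS](eq_bigr (fun j => h j ^+ m j)) => [|j ji]; last first.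
  by rewrite mnmBE mnm1E eq_sym (negPf ji) subn0.
rewrite [X in _ + _ * X](_ : _ = 0) ?mulr0 ?addr0 //.
elim/big_rec: _ => [|j y ji IH]; first by rewrite -(rmorph1 (@scal R N C)) der_scalar.
by rewrite derM IH der_exp dh eq_sym (negPf ji) !(mulr0, mul0r) addr0.
Qed.

Lemma der_mmap (h : 'I_N -> C) i Q : (forall j, der C i (h j) = (i == j)%:R) ->
  der C i (mmap (@scal R N C) h Q) = mmap (@scal R N C) h (mderiv i Q).
Proof.
move=> dh; elim/mpolyind: Q => [|a m Q _ _ IH]; first by rewrite !raddf0.
rewrite mderivD mderivZ mderivX !raddfD /= IH; congr (_ + _).
by rewrite !mmapZ !mmapX derM der_scalar mul0r add0r der_monomial // rmorph_nat.
Qed.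

Definition polyf Q : C := mmap (@scal R N C) (@crd R N C) Q.

Lemma evc_mmap (h : 'I_N -> C) x Q :
  evc C x (mmap (@scal R N C) h Q) = Q.@[fun i => evc C x (h i)].
Proof.
elim/mpolyind: Q => [|a m Q _ _ IH]; first by rewrite mmap0 meval0 rmorph0.
rewrite mmapD mevalD rmorphD IH /= mmapZ mevalZ rmorphM /= evc_scal mmapX mevalX.
by rewrite rmorph_prod; congr (_ * _ + _); apply: eq_bigr => i _; rewrite rmorphXn.
Qed.

Lemma der_polyf i Q : der C i (polyf Q) = polyf (mderiv i Q).
Proof. by apply: der_mmap => j; exact: der_crd. Qed.

Lemma evc_polyf x Q : evc C x (polyf Q) = Q.@[fun i => x 0 i].
Proof. by rewrite evc_mmap; apply: meval_eq => i; exact: evc_crd. Qed.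

Lemma msize_mderiv i Q : (msize (mderiv i Q) <= (msize Q).-1)%N.
Proof.
rewrite [X in (X <= _)%N]msizeE; apply/bigmax_leqP_seq => m; rewrite mcoeff_msupp => mQ _.
have : (m + U_(i))%MM \in msupp Q.
  rewrite mcoeff_msupp; apply: contra mQ => /eqP Q0.
  by rewrite mcoeff_mderiv Q0 mul0rn.
by move/msize_mdeg_lt; rewrite mdegD mdeg1 addn1; case: (msize Q).
Qed.

Lemma polyf_der3 i j k Q : (msize Q <= 3)%N ->
  der C i (der C j (der C k (polyf Q))) = 0.
Proof.
move=> Q3; rewrite !der_polyf (_ : mderiv i _ = 0) ?[polyf _]mmap0 //.
apply/eqP; rewrite -msize_poly_eq0 -leqn0.
apply: leq_trans (msize_mderiv _ _) _; move: (msize_mderiv j (mderiv k Q)).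
by move: (msize_mderiv k Q); lia.
Qed.

End Polynomials.

(** * A vanishing criterion for invariant operators *)

Section PolynomialTensors.
Variables (R : numFieldType) (N : nat) (C : coord_ring R N).
Notation symb := {mpoly C[N]}.
Implicit Types (f g : C) (S : symb) (i j : 'I_N) (b m : 'X_{1..N}) (l k : nat)
  (Q : {mpoly R[N]}) (Z : 'rV[C]_N).

Definition is_polyf f := exists Q, f = polyf C Q.

Lemma is_polyf_scal (a : R) : is_polyf (scal a).
Proof. by exists a%:MP; rewrite /polyf mmapC. Qed.

Lemma is_polyf_crd i : is_polyf (crd i).
Proof. by exists 'X_i; rewrite /polyf mmapX mmap1U. Qed.

Lemma is_polyfD f g : is_polyf f -> is_polyf g -> is_polyf (f + g).
Proof. by move=> [P ->] [Q ->]; exists (P + Q); rewrite /polyf mmapD. Qed.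

Lemma is_polyfM f g : is_polyf f -> is_polyf g -> is_polyf (f * g).
Proof. by move=> [P ->] [Q ->]; exists (P * Q); rewrite /polyf rmorphM. Qed.

Lemma is_polyfN f : is_polyf f -> is_polyf (- f).
Proof. by move=> [P ->]; exists (- P); rewrite /polyf mmapN. Qed.

Lemma is_polyf0 : is_polyf 0.
Proof. by exists 0; rewrite /polyf mmap0. Qed.

Lemma is_polyfMn f k : is_polyf f -> is_polyf (f *+ k).
Proof. by move=> [P ->]; exists (P *+ k); rewrite /polyf mmapMn. Qed.

Lemma is_polyf_der i f : is_polyf f -> is_polyf (der C i f).
Proof. by move=> [P ->]; exists (mderiv i P); exact: der_polyf. Qed.

Lemma is_polyf_sum (I : Type) (r : seq I) (F : I -> C) :
  (forall a, is_polyf (F a)) -> is_polyf (\sum_(a <- r) F a).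
Proof. by move=> hF; elim/big_rec: _ => [|a y _]; [exact: is_polyf0 | exact: is_polyfD]. Qed.

Lemma is_polyf_prod (I : Type) (r : seq I) (F : I -> C) :
  (forall a, is_polyf (F a)) -> is_polyf (\prod_(a <- r) F a).
Proof.
move=> hF; elim/big_rec: _ => [|a y _]; last exact: is_polyfM.
by rewrite -(rmorph1 (@scal R N C)); exact: is_polyf_scal.
Qed.

Lemma is_polyfX f k : is_polyf f -> is_polyf (f ^+ k).
Proof. by move=> [P ->]; exists (P ^+ k); rewrite /polyf rmorphXn. Qed.

Definition poly_tensor l S := S \is l.-homog /\ forall m, is_polyf S@_m.

Definition monT b m : symb := polyf C 'X_[b] *: 'X_[m].

Lemma homog_monT b m : monT b m \is (mdeg m).-homog.
Proof. by apply: dhomogZ; rewrite dhomogX. Qed.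

Lemma monT_coef b m m' : (monT b m)@_m' = polyf C 'X_[b] *+ (m == m').
Proof. by rewrite mcoeffZ mcoeffX mulr_natr. Qed.

Lemma poly_tensor_monT b m : poly_tensor (mdeg m) (monT b m).
Proof.
split; first exact: homog_monT.
by move=> k; rewrite monT_coef; apply: is_polyfMn; exists 'X_[b].
Qed.

Lemma poly_tensor_ind l (P : symb -> Prop) :
  P 0 -> (forall S S', P S -> P S' -> P (S + S')) ->
  (forall (a : R) S, P S -> P (scal a *: S)) ->
  (forall b m, mdeg m = l -> P (monT b m)) ->
  forall S, poly_tensor l S -> P S.
Proof.
move=> P0 PD PZ PT S [hS pS]; rewrite [S]mpolyE big_seq.
elim/big_rec: _ => // m S' mS; apply: (PD).
have [Q ->] := pS m; have ml := dhomog_mf hS mS.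
elim/mpolyind: Q => [|a b Q _ _ IH]; first by rewrite /polyf mmap0 scale0r.
rewrite /polyf mmapD scalerDl; apply: (PD) IH.
by rewrite mmapZ -scalerA; exact: PZ (PT _ _ ml).
Qed.

Lemma lie_coef (w : R) Z S m :
  (lie w Z S)@_m = \sum_i Z 0 i * der C i S@_m
    - \sum_i \sum_j der C j (Z 0 i) * ('X_i * mderiv j S)@_m
    + (scal w * \sum_i der C i (Z 0 i)) * S@_m.
Proof.
rewrite /lie mcoeffD mcoeffB mcoeffZ !(raddf_sum (mcoeff m)) /=; congr (_ - _ + _).
  by apply: eq_bigr => i _; rewrite mcoeffZ mcoeff_dsymb.
by apply: eq_bigr => i _; rewrite raddf_sum; apply: eq_bigr => j _; rewrite /= mcoeffZ.
Qed.

Lemma poly_tensor_lie (w : R) Z l S : (forall i, is_polyf (Z 0 i)) ->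
  poly_tensor l S -> poly_tensor l (lie w Z S).
Proof.
move=> pZ [hS pS]; split; first exact: homog_lie.
move=> m; rewrite lie_coef; apply: is_polyfD.
  apply: is_polyfD.
    by apply: is_polyf_sum => i; apply: is_polyfM (pZ i) _; exact: is_polyf_der.
  apply: is_polyfN; apply: is_polyf_sum => i; apply: is_polyf_sum => j.
  apply: is_polyfM; first exact: is_polyf_der.
  rewrite mcoeffXM; case: ifP => _; last exact: is_polyf0.
  by rewrite mcoeff_mderiv; exact: is_polyfMn.
apply: is_polyfM (pS m); apply: is_polyfM (is_polyf_scal w) _.
by apply: is_polyf_sum => i; exact: is_polyf_der.
Qed.

(** The list form of an operator is additive and linear over constants on all symbols, whereas a
    given D is controlled only on homogeneous ones. *)
Definition opf (s : seq ('X_{1..N} * 'X_{1..N} * symb)) S : symb :=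
  \sum_(t <- s) dmulti t.1.1 S@_t.1.2 *: t.2.

Variable s : seq ('X_{1..N} * 'X_{1..N} * symb).

Lemma opf_is_additive : zmod_morphism (opf s).
Proof.
move=> S S'; rewrite /opf -sumrB; apply: eq_bigr => t _.
by rewrite mcoeffB raddfB scalerBl.
Qed.
HB.instance Definition _ := GRing.isZmodMorphism.Build symb symb (opf s) opf_is_additive.

Lemma dmulti_scal b (a : R) f : dmulti b (scal a * f) = scal a * dmulti b f.
Proof.
rewrite /dmulti; elim: (enum _) => //= i e ->.
by elim: (b i) => //= c ->; rewrite derM der_scalar mul0r add0r.
Qed.

Lemma opfZ (a : R) S : opf s (scal a *: S) = scal a *: opf s S.
Proof.
rewrite /opf scaler_sumr; apply: eq_bigr => t _.
by rewrite mcoeffZ dmulti_scal scalerA.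
Qed.

Lemma der_monomialf i b : der C i (polyf C 'X_[b]) = (b i)%:R * polyf C 'X_[b - U_(i)].
Proof. by rewrite der_polyf mderivX /polyf mmapZ rmorph_nat. Qed.

Lemma crd_monomialf i b : crd i * polyf C 'X_[b] = polyf C 'X_[b + U_(i)].
Proof.
have -> : crd i = polyf C 'X_i by rewrite /polyf mmapX mmap1U.
by rewrite /polyf -rmorphM -mpolyXD addmC.
Qed.

Lemma monomial_diag i b : crd i * der C i (polyf C 'X_[b]) = polyf C 'X_[b] *+ b i.
Proof.
rewrite der_monomialf mulrCA crd_monomialf -[RHS]mulr_natl.
case: (posnP (b i)) => [->|bi]; first by rewrite !mul0r.
have le : (U_(i) <= b)%MM by rewrite lep1mP -lt0n.
by rewrite (submK le).
Qed.

Lemma lie_diag_coef (w : R) (a : 'I_N -> R) Z S m :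
  (forall i, Z 0 i = scal (a i) * crd i) ->
  (lie w Z S)@_m = \sum_i scal (a i) * (crd i * der C i S@_m)
    + scal (- \sum_i a i * (m i)%:R + w * \sum_i a i) * S@_m.
Proof.
move=> ZE; rewrite lie_coef -addrA; congr (_ + _).
  by apply: eq_bigr => i _; rewrite ZE mulrA.
have dZ i j : der C j (Z 0 i) = scal (a i) * (j == i)%:R.
  by rewrite ZE derM der_scalar der_crd mul0r add0r.
rewrite (eq_bigr (fun i => scal (a i * (m i)%:R) * S@_m)) => [|i _]; last first.
  rewrite (bigD1 i) //= big1 ?addr0 => [|j ji]; last by rewrite dZ (negPf ji) mulr0 mul0r.
  by rewrite dZ eqxx mulr1 mcoeff_X_mderiv rmorphM rmorph_nat -mulrA mulr_natl.
rewrite [in X in _ + X](eq_bigr (fun i => scal (a i))) => [|i _]; last first.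
  by rewrite dZ eqxx mulr1.
rewrite -mulr_suml -!raddf_sum -mulNr -rmorphN -rmorphM /= -mulrDl.
by rewrite -rmorphD.
Qed.

(** Monomial tensors are joint eigenvectors of the diagonal fields; the eigenvalues are the weights
    compared in [test_coef_eq0]. *)
Lemma lie_diag_monT (w : R) (a : 'I_N -> R) Z b m :
  (forall i, Z 0 i = scal (a i) * crd i) ->
  lie w Z (monT b m) =
  scal (\sum_i a i * ((b i)%:R - (m i)%:R) + w * \sum_i a i) *: monT b m.
Proof.
move=> ZE; apply/mpolyP => k; rewrite (lie_diag_coef _ _ _ ZE) [RHS]mcoeffZ !monT_coef.
case: eqVneq => [<-|_]; last first.
  by rewrite !mulr0n !mulr0 addr0 big1 // => i _; rewrite raddf0 !mulr0.
rewrite mulr1n (eq_bigr (fun i => scal (a i * (b i)%:R) * polyf C 'X_[b])); last first.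
  by move=> i _; rewrite monomial_diag rmorphM rmorph_nat -mulrA mulr_natl.
rewrite -mulr_suml -raddf_sum -mulrDl -rmorphD /=; congr (scal _ * _).
by rewrite addrA -sumrB; congr (_ + _); apply: eq_bigr => i _; rewrite mulrBr.
Qed.

End PolynomialTensors.

(** * Taylor polynomials and reduction to polynomial tensors *)

Section TaylorPolynomials.
Variables (R : numFieldType) (N : nat) (C : coord_ring R N).
Notation symb := {mpoly C[N]}.
Implicit Types (f g : C) (S : symb) (i j : 'I_N) (b m : 'X_{1..N}) (x : 'rV[R]_N).

Lemma dmulti_mmap (h : 'I_N -> C) b (Q : {mpoly R[N]}) :
  (forall i j, der C i (h j) = (i == j)%:R) ->
  dmulti b (mmap (@scal R N C) h Q) = mmap (@scal R N C) h Q^`M[b].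
Proof.
move=> dh; rewrite /dmulti /mderivm; elim: (enum _) => //= i e ->.
by elim: (b i) => //= c ->; exact: der_mmap.
Qed.

(** Derivatives at x and monomials centred at x are dual up to factorials, which is why [taylor] has
    the same jet as f at x. *)
Lemma evc_dmulti_monomial x b b' :
  evc C x (dmulti b' (mmap1 (fun i => crd i - scal (x 0 i)) b)) =
  (b == b')%:R * (\prod_i (b i)`!)%:R.
Proof.
set h := fun i => _; have dh i j : der C i (h j) = (i == j)%:R.
  by rewrite raddfB /= der_crd der_scalar subr0.
have h0 i : evc C x (h i) = 0 by rewrite rmorphB /= evc_crd evc_scal subrr.
rewrite -(mmapX h (@scal R N C)) dmulti_mmap // evc_mmap mderivmX mevalZ mevalX.
have [<-|bb'] := eqVneq b b'.
  rewrite mul1r [X in _ * X]big1 ?mulr1.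
    by congr (_%:R); apply: eq_bigr => i _; rewrite ffactnn.
  by move=> i _; rewrite mnmBE subnn expr0.
rewrite mul0r; have [i] : exists i, b i != b' i.
  apply/existsP; rewrite -negb_forall; apply: contra bb' => /forallP bb'.
  by apply/eqP/mnmP => i; exact/eqP.
rewrite neq_ltn => /orP[lt|gt].
  by rewrite [X in X%:R](bigD1 i) //= ffact_small // mul0n mul0r.
rewrite [X in _ * X](bigD1 i) //= h0 mnmBE expr0n subn_eq0 leqNgt gt /=.
by rewrite mul0r mulr0.
Qed.

Definition taylor r x f : C :=
  \sum_(b : 'X_{1..N < r.+1}) scal (evc C x (dmulti b f) / (\prod_i (b i)`!)%:R)
    * mmap1 (fun i => crd i - scal (x 0 i)) b.

Lemma taylor_is_additive r x : zmod_morphism (taylor r x).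
Proof.
move=> f g; rewrite /taylor -sumrB; apply: eq_bigr => b _.
by rewrite !raddfB /= mulrBl raddfB mulrBl.
Qed.
HB.instance Definition _ r x :=
  GRing.isZmodMorphism.Build C C (taylor r x) (taylor_is_additive r x).

Lemma is_polyf_taylor r x f : is_polyf (taylor r x f).
Proof.
apply: is_polyf_sum => b; apply: is_polyfM; first exact: is_polyf_scal.
apply: is_polyf_prod => i; apply: is_polyfX; apply: is_polyfD; first exact: is_polyf_crd.
by apply: is_polyfN; exact: is_polyf_scal.
Qed.

Lemma evc_dmulti_taylor r x f b : (mdeg b <= r)%N ->
  evc C x (dmulti b (taylor r x f)) = evc C x (dmulti b f).
Proof.
move=> br; rewrite /taylor !raddf_sum /=.
under eq_bigr do rewrite dmulti_scal rmorphM evc_scal evc_dmulti_monomial /=.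
have br' : (mdeg b < r.+1)%N by [].
rewrite (bigD1 (BMultinom br')) //= eqxx mul1r divfK; last first.
  by rewrite pnatr_eq0 -lt0n prodn_gt0 // => i; rewrite fact_gt0.
rewrite big1 ?addr0 // => b' b'b.
by rewrite -val_eqE /= in b'b; rewrite (negPf b'b) mul0r mulr0.
Qed.

(** At a point x the operator sees only a finite jet of the coefficients of S, so these may be
    replaced by their Taylor polynomials at x. *)
Lemma opf_eq0_on_polynomials (s : seq ('X_{1..N} * 'X_{1..N} * symb)) l :
  (forall b m, mdeg m = l -> opf s (monT C b m) = 0) ->
  forall S, S \is l.-homog -> opf s S = 0.
Proof.
move=> s0 S hS; apply/mpolyP => m; rewrite mcoeff0.
have [r] : exists r, all (fun t => mdeg t.1.1 <= r)%N s.
  exists (\max_(t <- s) mdeg t.1.1); apply/allP => t ts.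
  by rewrite (big_rem t) //= leq_maxl.
move/allP => sr; apply: evc_inj => x; rewrite rmorph0.
pose S' : symb := map_mpoly (taylor r x) S.
have S'c k : S'@_k = taylor r x S@_k by exact: mcoeff_map_mpoly.
have pS' : poly_tensor l S'.
  split; last by move=> k; rewrite S'c; exact: is_polyf_taylor.
  by apply/homog_coefP => k kl; rewrite S'c (dhomog_nemf_coeff hS kl) raddf0.
have S'0 : opf s S' = 0.
  move: S' pS' {S'c}; apply: poly_tensor_ind => //.
  - exact: raddf0.
  - by move=> S1 S2; rewrite raddfD /= => -> ->; rewrite addr0.
  - by move=> a S1; rewrite opfZ => ->; rewrite scaler0.
have : evc C x (opf s S')@_m = 0 by rewrite S'0 mcoeff0 rmorph0.
move=> <-; rewrite /opf !(raddf_sum (mcoeff m)) !(raddf_sum (evc C x)) /=.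
apply: eq_big_seq => t /sr tr.
by rewrite !mcoeffZ !rmorphM /= S'c evc_dmulti_taylor.
Qed.

End TaylorPolynomials.

(** * Constraints imposed by the fields of sp *)

Section Vanishing.
Variables (R : numFieldType) (n : nat) (C : coord_ring R (cdim n)) (delta : R).
Notation N := (cdim n).
Notation symb := {mpoly C[N]}.
Notation it := (it n).
Notation rweight := (rweight n delta).
Implicit Types (h f : C) (S F : symb) (i v : 'I_N) (j : 'I_n) (k l : nat) (b m : 'X_{1..N}).

Lemma poly_deg2P h :
  poly_deg2 h <-> exists2 Q : {mpoly R[N]}, (msize Q <= 3)%N & h = polyf C Q.
Proof.
split=> [[Q [Q3 hE]]|[Q Q3 ->]]; exists Q => //; last by split=> // x; exact: evc_polyf.
by apply: evc_inj => x; rewrite hE evc_polyf.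
Qed.

Lemma is_polyf_cfield h i : is_polyf h -> is_polyf (cfield h 0 i).
Proof.
move=> ph; have pd e : is_polyf (der C e h) by exact: is_polyf_der.
elim/cdim_ind: i => [j|j|].
- rewrite cfield_p; apply: is_polyfD; apply: is_polyfN => //.
  by apply: is_polyfM => //; exact: is_polyf_crd.
- rewrite cfield_q; apply: is_polyfD; [|apply: is_polyfN] => //.
  by apply: is_polyfM => //; exact: is_polyf_crd.
- rewrite cfield_t; apply: is_polyfD; last by apply: is_polyfN; exact: is_polyfMn.
  by apply: is_polyf_sum => j; apply: is_polyfD; apply: is_polyfM => //; exact: is_polyf_crd.
Qed.

Lemma poly_deg2_mulcrd i v : poly_deg2 (crd i * crd v : C).
Proof.
apply/poly_deg2P; exists ('X_[U_(i) + U_(v)]); first by rewrite msizeX mdegD !mdeg1.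
by rewrite /polyf mpolyXD rmorphM /= !mmapX !mmap1U.
Qed.

Lemma poly_deg2_crd i : poly_deg2 (crd i : C).
Proof.
apply/poly_deg2P; exists 'X_i; first by rewrite msizeX mdeg1.
by rewrite /polyf mmapX mmap1U.
Qed.

Lemma poly_deg2_1 : poly_deg2 (1 : C).
Proof.
apply/poly_deg2P; exists 1; first by rewrite msize1.
by rewrite /polyf rmorph1.
Qed.

Lemma cfield_1 i : cfield (1 : C) 0 i = scal (- 2) * (i == it)%:R.
Proof.
have d1 e : der C e 1 = 0 by rewrite -(rmorph1 (@scal R N C)) der_scalar.
have e0 : euler (1 : C) = 0 by rewrite /euler big1 // => j _; rewrite !d1 !mulr0 addr0.
elim/cdim_ind: i => [j|j|]; rewrite ?cfield_p ?cfield_q ?cfield_t !coordE /=.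
- by rewrite !d1 mul0r subr0 oppr0 mulr0.
- by rewrite !d1 mul0r subr0 mulr0.
- by rewrite e0 sub0r mulr1 rmorphN rmorph_nat.
Qed.

Lemma euler_crd i : euler (crd i : C) = crd i * (i != it)%:R.
Proof.
rewrite /euler; elim/cdim_ind: i => [j|j|]; rewrite !coordE /= ?mulr1 ?mulr0.
- rewrite -[RHS](sum_pick (fun e => crd (ip e)) j); apply: eq_bigr => e _.
  by rewrite !der_crd !coordE eq_sym mulr0 addr0.
- rewrite -[RHS](sum_pick (fun e => crd (iq e)) j); apply: eq_bigr => e _.
  by rewrite !der_crd !coordE eq_sym mulr0 add0r.
- by rewrite big1 // => j _; rewrite !der_crd !coordE !mulr0 addr0.
Qed.

Lemma cfield_crd_p j i :
  cfield (crd (ip j) : C) 0 i =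
    scal 1 * (i == iq j)%:R + scal (-1) * crd (ip j) * (i == it)%:R.
Proof.
rewrite rmorphN rmorph1.
elim/cdim_ind: i => [k|k|];
  rewrite ?cfield_p ?cfield_q ?cfield_t ?der_crd ?euler_crd ?coordE /=.
- by ring.
- by rewrite eq_sym; ring.
- by ring.
Qed.

Lemma cfield_crd_q j i :
  cfield (crd (iq j) : C) 0 i =
    scal (-1) * (i == ip j)%:R + scal (-1) * crd (iq j) * (i == it)%:R.
Proof.
rewrite rmorphN rmorph1.
elim/cdim_ind: i => [k|k|];
  rewrite ?cfield_p ?cfield_q ?cfield_t ?der_crd ?euler_crd ?coordE /=.
- by rewrite eq_sym; ring.
- by ring.
- by ring.
Qed.

Lemma scal_scale_eq0 (a : R) S : a != 0 -> scal a *: S = 0 -> S = 0.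
Proof.
move=> a0 /(congr1 (fun P => scal a^-1 *: P)).
by rewrite scaler0 scalerA -rmorphM mulVf // rmorph1 scale1r.
Qed.

(** These Heisenberg fields are divergence-free, so the density weight drops out. *)
Lemma lie_heis (w : R) (Z : 'rV[C]_N) (a c : R) u v S : v != it ->
  (forall i, Z 0 i = scal a * (i == u)%:R + scal c * crd v * (i == it)%:R) ->
  lie w Z S = scal a *: dsymb u S + scal c * crd v *: dsymb it S
              - scal c *: ('X_it * mderiv v S).
Proof.
move=> vt ZE.
have dZ i e : der C e (Z 0 i) = scal c * ((e == v)%:R * (i == it)%:R).
  rewrite ZE raddfD /= !derM !der_scalar der_crd !der_nat; ring.
have div0 : \sum_i der C i (Z 0 i) = 0.
  rewrite big1 // => i _; rewrite dZ.
  by case: (eqVneq i v) => [->|_]; rewrite ?(negPf vt) /=; ring.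
rewrite lieE div0 mulr0 scale0r addr0 /lie_der; congr (_ - _).
  under eq_bigr do rewrite ZE scalerDl; rewrite big_split /=; congr (_ + _).
    rewrite (bigD1 u) //= eqxx mulr1 big1 ?addr0 // => i /negPf ->.
    by rewrite mulr0 scale0r.
  rewrite (bigD1 it) //= eqxx mulr1 big1 ?addr0 // => i /negPf ->.
  by rewrite mulr0 scale0r.
rewrite (bigD1 it) //= [X in _ + X]big1 ?addr0 => [|i /negPf it0]; last first.
  by rewrite big1 // => e _; rewrite dZ it0 !mulr0 scale0r.
rewrite (bigD1 v) //= [X in _ + X]big1 ?addr0 => [|e /negPf ev]; last first.
  by rewrite dZ ev mul0r mulr0 scale0r.
by rewrite dZ !eqxx !mulr1.
Qed.

Hypothesis n_gt0 : (0 < n)%N.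
Let j0 : 'I_n := Ordinal n_gt0.
Let p1 : 'I_N := ip j0.
Let q1 : 'I_N := iq j0.

(** The field of 1 gives d_t F = 0; those of p_j and q_j then express every derivative of F as a
    multiple of xi_t times a fiber derivative of F. So the gradient of a coefficient involves only
    coefficients with a smaller power of xi_t, and each coefficient is constant, hence zero. *)
Lemma heis_invariants_eq0 F :
  (forall (Z : 'rV[C]_N) (a c : R) u v, sp_field Z -> v != it ->
     (forall i, Z 0 i = scal a * (i == u)%:R + scal c * crd v * (i == it)%:R) ->
     exists w : R, lie w Z F = 0) ->
  (forall m, evc C 0 F@_m = 0) -> F = 0.
Proof.
move=> FZ F0.
have heis h (a c : R) u v : poly_deg2 h -> v != it ->
    (forall i, cfield h 0 i = scal a * (i == u)%:R + scal c * crd v * (i == it)%:R) ->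
    scal a *: dsymb u F + scal c * crd v *: dsymb it F = scal c *: ('X_it * mderiv v F).
  move=> hp vt hE; have [|w] := FZ (cfield h) a c u v _ vt hE; first by exists h.
  by rewrite (lie_heis _ _ vt hE) => /eqP; rewrite subr_eq0 => /eqP.
have Ft : dsymb it F = 0.
  have := @heis 1 (- 2) 0 it p1 poly_deg2_1; rewrite coordE raddf0 mul0r !scale0r addr0.
  move=> /(_ isT) H; apply: (@scal_scale_eq0 (- 2)); first by rewrite oppr_eq0 pnatr_eq0.
  by apply: H => i; rewrite cfield_1 mul0r addr0.
have Fu u : exists c v, v != it /\ dsymb u F = c *: ('X_it * mderiv v F).
  elim/cdim_ind: u => [j|j|]; last by exists 0, p1; rewrite coordE scale0r.
  - have := heis (crd (iq j)) (-1) (-1) (ip j) (iq j) (poly_deg2_crd _).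
    rewrite coordE Ft scaler0 addr0 => /(_ isT (cfield_crd_q j)) E.
    exists 1, (iq j); rewrite coordE scale1r; split=> //.
    by apply: (oppr_inj); move: E; rewrite rmorphN rmorph1 !scaleN1r.
  - have := heis (crd (ip j)) 1 (-1) (iq j) (ip j) (poly_deg2_crd _).
    rewrite coordE Ft scaler0 addr0 => /(_ isT (cfield_crd_p j)).
    rewrite rmorph1 scale1r => ->.
    by exists (scal (-1)), (ip j); rewrite coordE.
apply/mpolyP => m; rewrite mcoeff0.
(* Induction on the exponent of xi_t; at exponent 0 the gradient has no source term. *)
move: {2}(m it) (leqnn (m it)) => c; elim: c m => [|c IH] m mc.
all: apply: evc_inj => x; rewrite rmorph0 -(F0 m); apply: gradient0 => u.
all: have [a [v [vt Fv]]] := Fu u; rewrite -mcoeff_dsymb Fv mcoeffZ mcoeffXM.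
  by move: mc; rewrite leqn0 => /eqP ->; rewrite mulr0.
case: ifP => [m0|_]; last by rewrite mulr0.
rewrite mcoeff_mderiv IH ?mul0rn ?mulr0 // mnmDE mnmBE !mnm1E eqxx (negPf vt).
by move: mc m0; case: (m it) => //= e; rewrite subn1 addn0.
Qed.

Lemma lie_coef_origin (w : R) (Z : 'rV[C]_N) F m : (forall i, evc C 0 (Z 0 i) = 0) ->
  evc C 0 (lie w Z F)@_m =
  - \sum_i \sum_e evc C 0 (der C e (Z 0 i)) * evc C 0 ('X_i * mderiv e F)@_m
  + w * evc C 0 (\sum_i der C i (Z 0 i)) * evc C 0 F@_m.
Proof.
move=> Z0; rewrite lie_coef rmorphD rmorphB !rmorphM /= evc_scal.
congr (_ + _); rewrite -[RHS]add0r; congr (_ - _).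
  by rewrite rmorph_sum big1 // => i _; rewrite rmorphM /= Z0 mul0r.
rewrite rmorph_sum; apply: eq_bigr => i _.
by rewrite rmorph_sum; apply: eq_bigr => e _; rewrite rmorphM.
Qed.

Lemma evc0_crd i : evc C 0 (crd i) = 0.
Proof. by rewrite evc_crd mxE. Qed.

Lemma evc0_euler f : evc C 0 (euler f) = 0.
Proof.
by rewrite rmorph_sum big1 // => j _; rewrite rmorphD !rmorphM /= !evc0_crd !mul0r addr0.
Qed.

(* The field of [q1 * v] vanishes at the origin; up to terms that do not involve  *)
(* ['X_p1], it acts on the fiber there as ['X_p1 * d/d('X_v)].                    *)
Lemma lie_raise (w : R) v F m : v != p1 ->
  (forall i e, i != p1 -> e != p1 -> evc C 0 ('X_i * mderiv e F)@_m = 0) ->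
  evc C 0 (lie w (cfield (crd q1 * crd v)) F)@_m =
  (1 + (v == q1)%:R) * evc C 0 ('X_p1 * mderiv v F)@_m.
Proof.
move=> vp1 F0; set h := crd q1 * crd v.
have dh e : evc C 0 (der C e h) = 0.
  by rewrite derM rmorphD !rmorphM /= !evc0_crd !(mulr0, mul0r) addr0.
(* For v = q1 the function is a square and both summands contribute, whence the factor 1 + (v == q1)
   in the conclusion. *)
have d2h e i : evc C 0 (der C e (der C i h)) =
    (i == q1)%:R * (e == v)%:R + (e == q1)%:R * (i == v)%:R.
  rewrite derM !der_crd raddfD /= !derM !der_crd !der_nat mul0r add0r mulr0 addr0.
  by rewrite rmorphD !rmorphM /= !rmorph_nat.
have Z0 i : evc C 0 (cfield h 0 i) = 0.
  elim/cdim_ind: i => [j|j|]; rewrite ?cfield_p ?cfield_q ?cfield_t.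
  - by rewrite rmorphB rmorphN rmorphM /= !dh mul0r subr0 oppr0.
  - by rewrite rmorphB rmorphM /= !dh mul0r subr0.
  - by rewrite rmorphB rmorphMn rmorphM /= evc0_euler evc0_crd mul0r mul0rn subr0.
rewrite lie_coef_origin // div_cfield rmorphM /= dh mulr0 mulr0 mul0r addr0.
have dZp j e : evc C 0 (der C e (cfield h 0 (ip j))) =
    - evc C 0 (der C (iq j) (der C e h)).
  by rewrite der_cfield_p !rmorphB rmorphN !rmorphM /= dh evc0_crd mulr0 mul0r !subr0.
have dZq j e : evc C 0 (der C e (cfield h 0 (iq j))) =
    evc C 0 (der C (ip j) (der C e h)).
  by rewrite der_cfield_q !rmorphB !rmorphM /= dh evc0_crd mulr0 mul0r !subr0.
have dZt e : evc C 0 (der C e (cfield h 0 it)) = 0.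
  rewrite cfield_t raddfB /= raddfMn /= euler_der rmorphB rmorphMn rmorphD rmorphM /=.
  by rewrite dh evc0_euler mulr0 mul0rn addr0 subr0.
have dZp1 i : evc C 0 (der C p1 (cfield h 0 i)) = 0.
  elim/cdim_ind: i => [j|j|]; rewrite ?dZp ?dZq // d2h (eq_sym p1 v) (negPf vp1) coordE /=.
    by rewrite mul0r mulr0 addr0 oppr0.
  by rewrite mul0r mulr0 addr0.
rewrite (bigD1 p1) //= [X in _ + X]big1 ?addr0 => [|i ip1]; last first.
  rewrite big1 // => e _; case: (eqVneq e p1) => [->|ep1]; first by rewrite dZp1 mul0r.
  by rewrite F0 ?mulr0.
under eq_bigr do rewrite /p1 dZp d2h -/p1 -/q1 eqxx mul1r mulNr mulrDl.
rewrite sumrN opprK big_split /= mulrDl mul1r addrC; congr (_ + _).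
  rewrite (bigD1 v) //= eqxx mul1r big1 ?addr0 // => e /negPf ->.
  by rewrite mul0r.
rewrite (bigD1 q1) //= eqxx mul1r big1 ?addr0 => [|e /negPf ->]; last by rewrite !mul0r.
by case: (eqVneq q1 v) => [<-|_]; rewrite ?eqxx ?mul0r.
Qed.

Lemma mnm_le_mdeg_eq (b b' : 'X_{1..N}) : (b <= b')%MM -> (mdeg b' <= mdeg b)%N -> b' = b.
Proof.
move=> le; rewrite -(submK le) mdegD -{2}[mdeg b]add0n leq_add2r leqn0 mdeg_eq0.
by move=> /eqP ->; rewrite add0m.
Qed.

Section InvariantOperator.
Variables (s : seq ('X_{1..N} * 'X_{1..N} * symb)) (k l : nat).
Hypothesis s_homog : forall S, S \is l.-homog -> opf s S \is k.-homog.
Hypothesis s_inv : sp_inv delta l k (opf s).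

(** Induction on the number of fiber factors other than xi_p1, for all S at once because S gets
    replaced by its Lie derivative. The field of q1 * v trades a factor xi_v for xi_p1. *)
Lemma coef_origin_eq0 :
  (forall S, poly_tensor l S -> evc C 0 (opf s S)@_(U_(p1) *+ k) = 0) ->
  forall S m, poly_tensor l S -> evc C 0 (opf s S)@_m = 0.
Proof.
move=> H0 S m; move: {2}(k - m p1)%N (leqnn (k - m p1)%N) => c.
elim: c m S => [|c IH] m S mc pS.
all: have [mk|mk] := eqVneq (mdeg m) k; last first.
all: try by rewrite (dhomog_nemf_coeff (s_homog pS.1) mk) rmorph0.
  rewrite (@mnm_le_mdeg_eq (U_(p1) *+ k) m) ?H0 //; last by rewrite mk mdegMn mdeg1 mul1n.
  apply/mnm_lepP => i; rewrite mulmnE mnm1E; case: eqP => [<-|_] //.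
  by rewrite mul1n -subn_eq0 -leqn0.
have [->|mU] := eqVneq m (U_(p1) *+ k)%MM; first exact: H0.
have [v vp1 mv] : exists2 v, v != p1 & (0 < m v)%N.
  apply/exists_inP; apply: contraNT mU; rewrite negb_exists_in => /forall_inP m0.
  have {}m0 v : v != p1 -> m v = 0%N by move/m0; rewrite -eqn0Ngt => /eqP.
  have mp1 : m p1 = k by rewrite -mk mdegE (bigD1 p1) //= big1 ?addn0.
  apply/eqP/mnmP => i; rewrite mulmnE mnm1E; case: eqVneq => [<-|ip1]; first by rewrite mul1n.
  by rewrite mul0n m0 // eq_sym.
pose m' := (m - U_(v) + U_(p1))%MM.
have m'p1 : m' p1 = (m p1).+1 by rewrite mnmDE mnmBE !mnm1E eqxx (negPf vp1) subn0 addn1.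
pose h : C := crd q1 * crd v.
have hZ : sp_field (cfield h) by exists h; split=> //; exact: poly_deg2_mulcrd.
have m'c : (k - m' p1 <= c)%N by rewrite m'p1; lia.
have pZ : poly_tensor l (lie (rweight l) (cfield h) S).
  apply: poly_tensor_lie pS => i; apply: is_polyf_cfield.
  by apply: is_polyfM; exact: is_polyf_crd.
(* The coefficient at m' vanishes by induction for the Lie derivative of S; by invariance and
   [lie_raise] it is a positive integer multiple of the coefficient at m for S itself. *)
have := IH m' _ m'c pZ; rewrite -(s_inv hZ pS.1) lie_raise // => [|i e ip1 ep1]; last first.
  (* Exchanging factors other than xi_p1 in m' keeps its larger exponent of xi_p1, so the induction
     hypothesis applies. *)
  rewrite mcoeffXM; case: ifP => _; last exact: rmorph0.
  rewrite mcoeff_mderiv rmorphMn /= IH ?mul0rn //.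
  by rewrite mnmDE mnmBE !mnm1E (negPf ip1) (negPf ep1) subn0 addn0.
rewrite mcoeffXM m'p1 /= /m' addmK mcoeff_mderiv submK; last by rewrite lep1mP -lt0n.
rewrite rmorphMn /= => /eqP; rewrite mulf_eq0 mulrn_eq0 /=.
by rewrite -(natrD _ 1) pnatr_eq0 addn_eq0 /= => /eqP.
Qed.

(** A Heisenberg field sends a monomial tensor to monomial tensors of smaller weight [wt]. By
    induction and invariance, the image under the operator is killed by all these fields, and it
    vanishes at the origin. *)
Lemma opf_monT_eq0 :
  (forall S m, poly_tensor l S -> evc C 0 (opf s S)@_m = 0) ->
  forall b m, mdeg m = l -> opf s (monT C b m) = 0.
Proof.
move=> H0 b m; pose wt (b m : 'X_{1..N}) := (mdeg b + b it + (l - m it))%N.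
move: {2}(wt b m).+1 (ltnSn (wt b m)) => W.
elim: W b m => // W IH b m bW ml.
(* Truncated subtraction of exponents is harmless: an exponent equal to 0 also appears as the factor
   c. *)
have zero (a : R) c b' m' : ((0 < c) -> mdeg m' = l /\ (wt b' m' < W))%N ->
    scal (a * c%:R) *: opf s (monT C b' m') = 0.
  case: (posnP c) => [->|c0 /(_ isT)[m'l /IH ->]] //; last by rewrite scaler0.
  by rewrite mulr0 raddf0 scale0r.
have mdeg1B i (e : 'X_{1..N}) : (0 < e i)%N -> (mdeg (e - U_(i))).+1 = mdeg e.
  by rewrite lt0n -lep1mP => /submK {2}<-; rewrite mdegD mdeg1 addn1.
have m_le i (e : 'X_{1..N}) : (e i <= mdeg e)%N by rewrite mdegE (bigD1 i) //= leq_addr.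
apply: heis_invariants_eq0 => [Z a c u v spZ vt ZE|m']; last first.
  by apply: H0; rewrite -ml; exact: poly_tensor_monT.
exists (rweight k); rewrite s_inv //; last by rewrite -ml; exact: homog_monT.
have -> : lie (rweight l) Z (monT C b m) =
    scal (a * (b u)%:R) *: monT C (b - U_(u)) m
    + scal (c * (b it)%:R) *: monT C (b - U_(it) + U_(v)) m
    - scal (c * (m v)%:R) *: monT C b (m - U_(v) + U_(it)).
  rewrite (lie_heis _ _ vt ZE) /monT !dsymbZ !dsymbX !scaler0 !addr0.
  rewrite !der_monomialf mderivZ mderivX !rmorphM !rmorph_nat !scalerA -!scalerAr.
  rewrite -mpolyXD [(U_(it) + _)%MM]addmC scalerA; congr (_ *: _ + _ *: _ - _).
  - by rewrite mulrA.
  - by rewrite mulrCA !mulrA -crd_monomialf; ring.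
  - by congr (_ *: _); ring.
have vit : (it == v) = false by rewrite eq_sym (negPf vt).
rewrite raddfB raddfD /= !opfZ !zero ?addr0 ?subr0 // => [c0|c0|c0].
- have := mdeg1B _ _ c0; have := m_le it (m - U_(v))%MM; move: bW.
  rewrite /wt mdegD mdeg1 !mnmDE !mnmBE !mnm1E eqxx (negPf vt) ml; lia.
- split=> //; have := mdeg1B _ _ c0; move: bW; rewrite /wt.
  rewrite mdegD mdeg1 !mnmDE !mnmBE !mnm1E eqxx (negPf vt); lia.
- split=> //; have := mdeg1B _ _ c0; move: bW; rewrite /wt !mnmBE; lia.
Qed.

(** The two weight equations give m p1 + m it >= l + b p1 + m q1 + b it, while m has degree l; hence
    all the inequalities are equalities and no other exponent survives. *)
Lemma weight_pigeonhole b m : mdeg m = l ->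
  (mdeg b + b it + l = k + m it)%N -> (b q1 + m p1 = k + b p1 + m q1)%N ->
  [/\ (m p1 <= l)%N, (m p1 <= k)%N, b = (U_(q1) *+ (k - m p1))%MM
    & m = (U_(p1) *+ (m p1) + U_(it) *+ (l - m p1))%MM].
Proof.
move=> ml E1 E2.
have hb : (b q1 <= mdeg b)%N by rewrite mdegE (bigD1 q1) //= leq_addr.
have hm : (m p1 + m it <= mdeg m)%N.
  by rewrite mdegE (bigD1 p1) //= (bigD1 it) /= ?coordE // addnA leq_addr.
have [mk hbk hmk] : [/\ (m p1 <= k)%N, (b q1 = k - m p1)%N & (m it = l - m p1)%N].
  by split; lia.
split=> //; first lia.
- apply: mnm_le_mdeg_eq; last by rewrite mdegMn mdeg1 mul1n; lia.
  apply/mnm_lepP => i; rewrite mulmnE mnm1E.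
  by case: eqP => [<-|_]; rewrite ?mul0n // mul1n hbk.
- apply: mnm_le_mdeg_eq; last by rewrite mdegD !mdegMn !mdeg1 !mul1n; lia.
  apply/mnm_lepP => i; rewrite mnmDE !mulmnE !mnm1E.
  case: (eqVneq p1 i) => [<-|_]; first by rewrite coordE mul0n addn0 mul1n.
  by case: eqP => [<-|_] //; rewrite mul0n mul1n hmk.
Qed.

(** The functions t and p1 * q1 have diagonal fields. Invariance forces the coefficient to vanish
    unless the weights of the monomial tensor match those of xi_p1^k at the origin. *)
Lemma test_coef_eq0 :
  (forall a, (a <= l)%N -> (a <= k)%N ->
    evc C 0 (opf s (monT C (U_(q1) *+ (k - a))
                           (U_(p1) *+ a + U_(it) *+ (l - a))))@_(U_(p1) *+ k) = 0) ->
  forall S, poly_tensor l S -> evc C 0 (opf s S)@_(U_(p1) *+ k) = 0.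
Proof.
move=> H0; apply: poly_tensor_ind => [|S S' E E'|a S E|b m ml].
- by rewrite raddf0 mcoeff0 rmorph0.
- by rewrite raddfD mcoeffD rmorphD /= E E' addr0.
- by rewrite opfZ mcoeffZ rmorphM /= E mulr0.
have diag (Z : 'rV[C]_N) (a : 'I_N -> R) : sp_field Z ->
    (forall i, Z 0 i = scal (a i) * crd i) ->
    (\sum_i a i * ((b i)%:R - (m i)%:R) + rweight l * \sum_i a i
     == - a p1 * k%:R + rweight k * \sum_i a i)
    || (evc C 0 (opf s (monT C b m))@_(U_(p1) *+ k) == 0).
  move=> spZ ZE; have hT : monT C b m \is l.-homog by rewrite -ml; exact: homog_monT.
  have := congr1 (fun P => evc C 0 P@_(U_(p1) *+ k)) (s_inv spZ hT).
  rewrite (lie_diag_monT _ _ _ ZE) opfZ mcoeffZ (lie_diag_coef _ _ _ ZE) rmorphD !rmorphM /=.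
  rewrite rmorph_sum big1 => [|i _]; last by rewrite !rmorphM /= evc0_crd mul0r mulr0.
  have -> : \sum_i a i * ((U_(p1) *+ k)%MM i)%:R = a p1 * k%:R.
    rewrite (bigD1 p1) //= mulmnE mnm1E eqxx mul1n big1 ?addr0 // => i ip1.
    by rewrite mulmnE mnm1E eq_sym (negPf ip1) mul0n mulr0.
  by rewrite add0r !evc_scal => /esym/eqP; rewrite -subr_eq0 -mulrBl mulf_eq0 subr_eq0 mulNr.
have sumU (F : 'I_N -> R) i : \sum_e (e == i)%:R * F e = F i.
  rewrite (bigD1 i) //= eqxx mul1r big1 ?addr0 // => e /negPf ->; exact: mul0r.
have sum1U i : \sum_e (e == i)%:R = 1 :> R.
  by rewrite -[RHS](sumU (fun=> 1) i); apply: eq_bigr => e _; rewrite mulr1.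
have sumD : \sum_e ((b e)%:R - (m e)%:R) = (mdeg b)%:R - l%:R :> R.
  by rewrite sumrB -!natr_sum -!mdegE ml.
have n0 : n.+1%:R != 0 :> R by rewrite pnatr_eq0.
have Zt i : cfield (crd it : C) 0 i = scal (- 1 - (i == it)%:R) * crd i.
  rewrite rmorphB rmorphN rmorph1 rmorph_nat.
  elim/cdim_ind: i => [j|j|];
    rewrite ?cfield_p ?cfield_q ?cfield_t ?(der_crd, euler_crd) !coordE /=; ring.
have euler_pq : euler (crd p1 * crd q1 : C) = crd p1 * crd q1 *+ 2.
  rewrite (_ : euler _ = crd p1 * euler (crd q1) + crd q1 * euler (crd p1)).
    by rewrite !euler_crd !coordE /=; ring.
  by rewrite /euler !mulr_sumr -big_split; apply: eq_bigr => j _; rewrite !derM /=; ring.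
have Zpq i : cfield (crd p1 * crd q1 : C) 0 i = scal ((i == q1)%:R - (i == p1)%:R) * crd i.
  rewrite rmorphB !rmorph_nat /p1 /q1.
  elim/cdim_ind: i => [j|j|].
  - by rewrite cfield_p !derM !der_crd !coordE /=; case: eqVneq => [->|_] /=; ring.
  - by rewrite cfield_q !derM !der_crd !coordE /=; case: eqVneq => [->|_] /=; ring.
  - by rewrite cfield_t euler_pq !coordE /=; ring.
have /orP[/eqP Et|/eqP //] := diag _ _ (ex_intro _ _ (conj (poly_deg2_crd it) erefl)) Zt.
have /orP[/eqP Epq|/eqP //] :=
  diag _ _ (ex_intro _ _ (conj (poly_deg2_mulcrd p1 q1) erefl)) Zpq.
have {Epq}Epq : (b q1 + m p1 = k + b p1 + m q1)%N.
  apply/eqP; rewrite -(eqr_nat R) !natrD; apply/eqP.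
  move: Epq; rewrite sumrB !sum1U subrr !mulr0 !addr0 /p1 /q1 !coordE.
  under eq_bigr do rewrite mulrBl; rewrite sumrB !sumU /= sub0r opprK mul1r => E.
  by rewrite -E; ring.
have {Et}Et : (mdeg b + b it + l = k + m it)%N.
  apply/eqP; rewrite -(eqr_nat R) !natrD; apply/eqP.
  move: Et; rewrite sumrB sum1U sumr_const card_ord /p1 !coordE subr0.
  under eq_bigr do rewrite mulrBl mulN1r; rewrite sumrB sumrN sumD sumU /= => E.
  have N1 : - 1 *+ (n + n + 1) - 1 = - (2 * n.+1%:R) :> R.
    by rewrite mulNrn !natrD -natr1; ring.
  (* The part in delta is the same for r = k and r = l, so it cancels and an equation between
     natural numbers remains. *)
  have wE (r : nat) : rweight r * - (2 * n.+1%:R) = - (2 * n.+1%:R) * delta - 2 * r%:R.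
    by rewrite /rweight mulrN mulrDl [_ / _ * _]mulrCA divfK //; ring.
  apply/eqP; rewrite -subr_eq0 -oppr_eq0; move/eqP: E; rewrite -subr_eq0 N1 !wE.
  by congr (_ == _); ring.
have [ml1 mk1 bE mE] := weight_pigeonhole ml Et Epq.
by have := H0 _ ml1 mk1; rewrite -bE -mE.
Qed.

Lemma invariant_eq0 :
  (forall a, (a <= l)%N -> (a <= k)%N ->
    evc C 0 (opf s (monT C (U_(q1) *+ (k - a))
                           (U_(p1) *+ a + U_(it) *+ (l - a))))@_(U_(p1) *+ k) = 0) ->
  forall S, S \is l.-homog -> opf s S = 0.
Proof.
by move=> H; apply/opf_eq0_on_polynomials/opf_monT_eq0/coef_origin_eq0/test_coef_eq0.
Qed.

End InvariantOperator.
End Vanishing.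

(** * Classification *)

Section Classification.
Variables (R : numFieldType) (n : nat) (C : coord_ring R (cdim n)) (delta : R).
Notation N := (cdim n).
Notation symb := {mpoly C[N]}.
Notation it := (it n).
Notation gen := (@gen R n C delta).
Implicit Types (h f : C) (S F : symb) (i : 'I_N) (k l m a r : nat).

Lemma lie_is_additive (w : R) (Z : 'rV[C]_N) : zmod_morphism (lie w Z).
Proof.
move=> S S'; rewrite !lieE (derivation_lie_der Z).1 scalerBr.
by move: (lie_der Z S) (lie_der Z S') => A B; rewrite addrACA opprD.
Qed.
HB.instance Definition _ w Z :=
  GRing.isZmodMorphism.Build symb symb (lie w Z) (lie_is_additive w Z).

Lemma lie_scal (w : R) (Z : 'rV[C]_N) (c : R) S : lie w Z (scal c *: S) = scal c *: lie w Z S.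
Proof.
rewrite !lieE scalerDr !scalerA [scal c * _]mulrC; congr (_ + _).
rewrite -!mul_mpolyC (derivation_lie_der Z).2 lie_derC big1 ?mpolyC0 ?mul0r ?add0r //.
by move=> i _; rewrite der_scalar mulr0.
Qed.

Lemma gen_comb_invariant k l (c : nat -> R) (D : symb -> symb) :
  (forall S, S \is l.-homog ->
     D S = \sum_(maxn 0 (k - l) <= m < k.+1) scal (c m) *: gen l k m S) ->
  diff_op l k D /\ sp_inv delta l k D.
Proof.
move=> DE; have range m : m \in index_iota (maxn 0 (k - l)) k.+1 ->
    (k <= l + m)%N /\ (m <= k)%N by rewrite mem_index_iota; lia.
split.
  apply: dop_diff_op => [S hS|].
    rewrite DE // big_seq; apply: rpred_sum => m /range[klm mk].
    exact/dhomogZ/homog_gen.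
  apply: dop_ext DE _; apply: dop_bigsum => m; apply: dop_scale; exact: dop_gen.
move=> _ [h [/poly_deg2P[Q Q3 hE] ->]] S hS.
rewrite !DE //; last exact: homog_lie.
rewrite raddf_sum big_seq [RHS]big_seq; apply: eq_bigr => m /range[klm mk] /=.
rewrite lie_scal lie_gen // => i j e; rewrite hE; exact: polyf_der3.
Qed.

Hypothesis n_gt0 : (0 < n)%N.
Let j0 : 'I_n := Ordinal n_gt0.
Let p1 : 'I_N := ip j0.
Let q1 : 'I_N := iq j0.

(** On k-homogeneous symbols this is the coefficient of xi_p1^k; as evaluation of the fiber at dp1
    it is also multiplicative, so it can be pushed through X. *)
Definition fiber_ev S : C := S.@[fun i => (i == p1)%:R].
HB.instance Definition _ :=
  GRing.RMorphism.copy fiber_ev (meval (fun i => (i == p1)%:R : C)).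

Lemma fiber_evX i : fiber_ev 'X_i = (i == p1)%:R.
Proof. exact: mevalXU. Qed.

Lemma fiber_evZ f S : fiber_ev (f *: S) = f * fiber_ev S.
Proof. exact: mevalZ. Qed.

Lemma fiber_ev_homog k S : S \is k.-homog -> fiber_ev S = S@_(U_(p1) *+ k).
Proof.
move=> hS; rewrite /fiber_ev mevalE.
have prodE (m : 'X_{1..N}) :
    \prod_i (((i == p1)%:R : C) ^+ m i) = (m == (U_(p1) *+ (m p1))%MM)%:R.
  have [mE|mE] := eqVneq m (U_(p1) *+ (m p1))%MM.
    rewrite big1 // => i _; have -> : m i = ((p1 == i) * m p1)%N.
      by rewrite {1}mE mulmnE mnm1E.
    by case: (eqVneq p1 i); rewrite ?expr1n.
  have [i ip1 mi] : exists2 i, i != p1 & m i != 0%N.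
    apply/exists_inP; apply: contraNT mE; rewrite negb_exists_in => /forall_inP m0.
    apply/eqP/mnmP => i; rewrite mulmnE mnm1E; case: (eqVneq p1 i) => [<-|pi].
      by rewrite mul1n.
    by rewrite mul0n; apply/eqP; have := m0 i; rewrite negbK eq_sym; apply.
  by rewrite (bigD1 i) //= (negPf ip1) expr0n (negPf mi) mul0r.
case: (boolP ((U_(p1) *+ k)%MM \in msupp S)) => [inS|notS].
  rewrite (bigD1_seq (U_(p1) *+ k)%MM) ?msupp_uniq //= prodE mulmnE mnm1E eqxx mul1n eqxx.
  rewrite mulr1 big_seq_cond big1 ?addr0 // => m /andP[mS mU]; rewrite prodE.
  case: eqP => [mE|_]; last by rewrite mulr0.
  have mp : m p1 = k by rewrite -(dhomog_mf hS mS) /= {2}mE mdegMn mdeg1 mul1n.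
  by move: mU; rewrite {1}mE mp eqxx.
rewrite (memN_msupp_eq0 notS) big_seq big1 // => m mS; rewrite prodE.
case: eqP => [mE|_]; last by rewrite mulr0.
have mp : m p1 = k by rewrite -(dhomog_mf hS mS) /= {2}mE mdegMn mdeg1 mul1n.
by move: notS; rewrite -mp -mE mS.
Qed.

Lemma fiber_ev_dsymb i S : fiber_ev (dsymb i S) = der C i (fiber_ev S).
Proof.
rewrite /fiber_ev; elim/mpolyind: S => [|c m S _ _ IH]; first by rewrite !raddf0.
rewrite !raddfD /= IH dsymbZ dsymbX scaler0 addr0 !mevalZ mevalX derM.
rewrite [X in _ = _ + _ * X + _](_ : _ = 0) ?mulr0 ?addr0 //.
under eq_bigr do rewrite -natrX.
by rewrite -natr_prod der_nat.
Qed.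

Definition hder f : C := - (der C q1 f + crd p1 * der C it f).

(* Evaluating the fiber variables at [dp1] kills [xi_t] and turns the operator X  *)
(* into the vector field [- d/dq1 - p1 d/dt], whatever the weight.                *)
Lemma fiber_ev_gham (w : R) k S : fiber_ev (gham w k S) = hder (fiber_ev S).
Proof.
rewrite /gham rmorphD rmorphB rmorphD /= fiber_evZ !rmorphM /= !fiber_evX fiber_ev_dsymb.
rewrite /p1 !coordE !mul0r mulr0 !addr0 /hder opprD; congr (_ - _ * _).
  rewrite raddf_sum /= (bigD1 j0) //= big1 ?addr0 => [|j jj0].
    by rewrite rmorphB !rmorphM /= !fiber_evX !coordE !fiber_ev_dsymb /=; ring.
  by rewrite rmorphB !rmorphM /= !fiber_evX !coordE (negPf jj0) !mul0r subr0.
rewrite raddf_sum /= (bigD1 j0) //= big1 ?addr0 => [|j jj0].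
  by rewrite rmorphD /= !fiber_evZ !fiber_evX !coordE /=; ring.
by rewrite rmorphD /= !fiber_evZ !fiber_evX !coordE (negPf jj0) /=; ring.
Qed.

Lemma fiber_ev_xpow k m S : fiber_ev (xpow delta k m S) = iter m hder (fiber_ev S).
Proof. by elim: m => //= m <-; exact: fiber_ev_gham. Qed.

(** Since [ialph] kills this symbol ([ialph_horiz]), it acts on the test tensors below only through
    the power of xi_t. *)
Definition horiz : symb := 'X_p1 - crd q1 *: 'X_it.

Definition test k l a : symb :=
  (crd q1 ^+ (k - a)) *: (horiz ^+ a * 'X_it ^+ (l - a)).

Lemma homog_test k l a : (a <= l)%N -> test k l a \is l.-homog.
Proof.
move=> al; apply: dhomogZ; rewrite -{2}(subnKC al); apply: dhomogM.
  rewrite -[a in X in X.-homog]mul1n; apply: dhomogMn; apply: rpredB.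
    by rewrite dhomogX /= mdeg1.
  by apply: dhomogZ; rewrite dhomogX /= mdeg1.
by rewrite -[(l - a)%N in X in X.-homog]mul1n; apply: dhomogMn; rewrite dhomogX /= mdeg1.
Qed.

Lemma ialphZ f S : ialph (f *: S) = f *: ialph S.
Proof. by rewrite -!mul_mpolyC (@derivation_ialph R n C).2 ialph_C mul0r add0r. Qed.

Lemma ialph_horiz : ialph horiz = 0.
Proof.
rewrite (@derivation_ialph R n C).1 ialphZ !ialph_X alpha_p alpha_t -mul_mpolyC.
rewrite -mpolyCM -mpolyCB (_ : _ - _ = 0) ?mpolyC0 //.
by rewrite /q1; ring.
Qed.

Lemma iter_ialph_horiz r a b :
  iter r (@ialph R n C) (horiz ^+ a * 'X_it ^+ b) =
  scal ((b ^_ r)%:R * (- 2^-1) ^+ r) *: (horiz ^+ a * 'X_it ^+ (b - r)).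
Proof.
have di := @derivation_ialph R n C.
have dX S c : ialph (S ^+ c) = c%:R * S ^+ c.-1 * ialph S.
  elim: c => [|c IH]; first by rewrite !mul0r expr0 -mpolyC1 ialph_C.
  rewrite exprS di.2 IH; case: c {IH} => [|c]; first by rewrite expr0; ring.
  by rewrite /= exprS -[c.+2%:R]natr1; ring.
elim: r => [|r IH] /=; first by rewrite ffactn0 mulr1 rmorph1 scale1r subn0.
rewrite IH ialphZ di.2 dX ialph_horiz mulr0 mul0r add0r dX ialph_X alpha_t.
rewrite ffactnSr subnS -rmorphN exprSr natrM.
rewrite [_ * (scal _)%:MP]mulrC mulrA mulrCA -mulrA -!mul_mpolyC.
rewrite !rmorphM /= !rmorph_nat; ring.
Qed.

Lemma iter_hder m (c : R) : iter m hder (scal c * crd q1 ^+ m) = scal (c * (-1) ^+ m * m`!%:R).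
Proof.
elim: m c => [|m IH] c; first by rewrite /= !expr0 !mulr1.
rewrite iterSr [hder _](_ : _ = scal (c * - m.+1%:R) * crd q1 ^+ m).
  by rewrite IH exprS factS natrM; congr (scal _); ring.
rewrite /hder !derM !der_scalar !der_exp !der_crd coordE /q1 coordE /=.
by rewrite rmorphM rmorphN rmorph_nat; ring.
Qed.

Definition test_value k l a : R :=
  ((l - a) ^_ (l - a))%:R * (- 2^-1) ^+ (l - a) * (-1) ^+ (k - a) * (k - a)`!%:R.

(** The test tensor with parameter a detects only the generator with m = k - a: fewer applications
    of [ialph] leave a power of xi_t, which [fiber_ev] kills, and more of them give zero. *)
Lemma gen_test k l m a : (k <= l + m)%N -> (m <= k)%N -> (a <= l)%N -> (a <= k)%N ->
  evc C 0 (gen l k m (test k l a))@_(U_(p1) *+ k) =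
  (m == k - a)%N%:R * test_value k l a.
Proof.
move=> klm mk al ak.
rewrite -(fiber_ev_homog (homog_gen _ klm mk (homog_test k al))).
rewrite /gen fiber_ev_xpow.
have -> : iter (l + m - k) (@ialph R n C) (test k l a) = crd q1 ^+ (k - a) *:
    iter (l + m - k) (@ialph R n C) (horiz ^+ a * 'X_it ^+ (l - a)).
  by rewrite /test; elim: (l + m - k)%N => //= r ->; rewrite ialphZ.
rewrite iter_ialph_horiz /fiber_ev !mevalZ mevalM !rmorphXn /= mevalXU it_ip.
rewrite /horiz mevalB mevalZ !mevalXU eqxx it_ip mulr0 subr0 expr1n mul1r.
have [mE|mE] := eqVneq m (k - a)%N.
  have -> : (l + m - k = l - a)%N by lia.
  by rewrite subnn expr0 mulr1 mul1r mulrC mE iter_hder evc_scal.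
rewrite mul0r [X in iter _ _ X](_ : _ = 0).
  have -> : iter m hder 0 = 0; last exact: rmorph0.
  by elim: m {mk klm mE} => //= m ->; rewrite /hder !raddf0 mulr0 addr0 oppr0.
(* If m < k - a, xi_t survives with exponent k - a - m > 0; if m > k - a, the falling factorial is
   zero. *)
case: (ltngtP m (k - a)) mE => // mlt _.
  by rewrite expr0n (_ : (_ == 0)%N = false) ?mulr0 //; lia.
by rewrite ffact_small ?mul0r ?raddf0 ?mul0r ?mulr0 //; lia.
Qed.

Lemma test_value_neq0 k l a : test_value k l a != 0.
Proof.
rewrite /test_value ffactnn !mulf_neq0 ?expf_neq0 ?oppr_eq0 ?invr_eq0 ?oner_eq0 //.
all: by rewrite pnatr_eq0 -?lt0n ?fact_gt0.
Qed.

(** Binomial expansion of xi_p1 = [horiz] + q1 xi_t. Only parameters at most a occur, so vanishing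
    on test tensors gives the hypothesis of [invariant_eq0]. *)
Lemma monT_test k l a : (a <= l)%N -> (a <= k)%N ->
  monT C (U_(q1) *+ (k - a)) (U_(p1) *+ a + U_(it) *+ (l - a)) =
  \sum_(i < a.+1) test k l (a - i) *+ 'C(a, i).
Proof.
move=> al ak; rewrite /monT /polyf mmapX /mmap1.
have -> : \prod_i (crd i ^+ (U_(q1) *+ (k - a))%MM i) = crd q1 ^+ (k - a) :> C.
  rewrite (bigD1 q1) //= mulmnE mnm1E eqxx mul1n big1 ?mulr1 // => i iq1.
  by rewrite mulmnE mnm1E eq_sym (negPf iq1) mul0n expr0.
rewrite mpolyXD -!mpolyXn.
rewrite [in LHS](_ : 'X_p1 = horiz + crd q1 *: 'X_it); last by rewrite /horiz subrK.
rewrite exprDn mulr_suml scaler_sumr; apply: eq_bigr => i _.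
rewrite mulrnAl -scalerMnr /test; congr (_ *+ _).
rewrite exprZn -scalerAr -scalerAl scalerA -exprD -mulrA -exprD.
by congr (_ ^+ _ *: (_ * _ ^+ _)); have := ltn_ord i; lia.
Qed.

Theorem invariant_operators k l (D : symb -> symb) :
  (diff_op l k D /\ sp_inv delta l k D) <->
  exists c : nat -> R, forall S, S \is l.-homog ->
    D S = \sum_(maxn 0 (k - l) <= m < k.+1) scal (c m) *: gen l k m S.
Proof.
split=> [[Dop Dinv]|[c DE]]; last exact: gen_comb_invariant DE.
pose tv a : R := evc C 0 (D (test k l a))@_(U_(p1) *+ k).
(* By [gen_test], the m-th coefficient is read off on the test tensor with a = k - m. *)
pose c m : R := tv (k - m)%N / test_value k l (k - m).
exists c; pose G S := \sum_(maxn 0 (k - l) <= m < k.+1) scal (c m) *: gen l k m S.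
have [Gop Ginv] : diff_op l k G /\ sp_inv delta l k G by exact: gen_comb_invariant.
have [s sE] := dop_sub (diff_op_dop Dop) (diff_op_dop Gop).
have opE S : S \is l.-homog -> opf s S = D S - G S by move/sE.
move=> S hS; apply/eqP; rewrite -subr_eq0; apply/eqP.
rewrite -[LHS]/(D S - G S) -opE //; move: S hS.
apply: (@invariant_eq0 _ _ _ delta n_gt0 s k l) => [S hS|Z spZ S hS|a al ak].
- by rewrite opE //; apply: rpredB; [exact: Dop.1 | exact: Gop.1].
- by rewrite !opE ?raddfB /= ?Dinv ?Ginv //; exact: homog_lie.
have test0 a' : (a' <= a)%N -> evc C 0 (opf s (test k l a'))@_(U_(p1) *+ k) = 0.
  move=> a'a; have a'l := leq_trans a'a al; have a'k := leq_trans a'a ak.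
  rewrite opE; last exact: homog_test.
  rewrite mcoeffB rmorphB /= -/(tv a') /G raddf_sum rmorph_sum /=.
  rewrite big_seq (eq_bigr (fun m => (m == k - a')%N%:R * tv a')) => [|m]; last first.
    rewrite mem_index_iota => mr; rewrite mcoeffZ rmorphM /= evc_scal gen_test //; try lia.
    case: eqP => [mE|_]; last by rewrite !mul0r mulr0.
    by rewrite !mul1r /c mE subKn // divfK // test_value_neq0.
  have mem : (k - a')%N \in index_iota (maxn 0 (k - l)) k.+1.
    by rewrite mem_index_iota; lia.
  rewrite -big_seq (bigD1_seq _ mem) ?iota_uniq //=.
  rewrite eqxx mul1r big1 ?addr0 ?subrr // => m /negPf ->.
  by rewrite mul0r.
rewrite -/j0 -/p1 -/q1 monT_test // (raddf_sum (opf s)) (raddf_sum (mcoeff _)).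
rewrite rmorph_sum big1 // => i _.
by rewrite /= (raddfMn (opf s)) /= mcoeffMn rmorphMn /= test0 ?mul0rn // leq_subr.
Qed.

End Classification.

(** * Smooth functions as an instance of the abstract ring *)

Section SmoothCoordRing.
Variables (R : realType) (N : nat).
Notation C := (Cinf R N).

Definition Cinf_ev (x : 'rV[R]_N) (f : C) : R := f x.

Lemma Cinf_ev_is_additive x : zmod_morphism (Cinf_ev x). Proof. by []. Qed.
Lemma Cinf_ev_is_multiplicative x : monoid_morphism (Cinf_ev x). Proof. by []. Qed.
HB.instance Definition _ x :=
  GRing.isZmodMorphism.Build C R (Cinf_ev x) (Cinf_ev_is_additive x).
HB.instance Definition _ x :=
  GRing.isMonoidMorphism.Build C R (Cinf_ev x) (Cinf_ev_is_multiplicative x).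

Definition Cinf_coord_ring : coord_ring R N := {|
  cr_ring := C;
  der i := dC i;
  scal := @constC R N;
  crd := @coordC R N;
  evc x := Cinf_ev x;
  derM := @dCM R N;
  der_comm := @dC_comm R N;
  der_scalar := @dC_const R N;
  der_crd := @dC_coord R N;
  evc_scal x := @constCE R N ^~ x;
  evc_crd x := @coordCE R N ^~ x;
  evc_inj := @Cinf_ext R N;
  gradient0 := @gradient0_const R N
|}.

End SmoothCoordRing.

Theorem theorem4 (R : realType) (n : nat) (hn : (1 <= n)%N) (delta : R)
    (k l : nat)
    (D : {mpoly (Cinf R (cdim n))[cdim n]} -> {mpoly (Cinf R (cdim n))[cdim n]}) :
  (is_diff_op l k D /\ sp_invariant delta l k D) <->
  exists c : nat -> R,
    forall S : {mpoly (Cinf R (cdim n))[cdim n]}, S \is l.-homog ->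
      D S = \sum_(maxn 0 (k - l) <= m < k.+1)
              constC (c m) *: gen_op delta l k m S.
Proof.
(* At [Cinf_coord_ring] the abstract notions are convertible to those of the statement. *)
exact: (@invariant_operators R n (Cinf_coord_ring R (cdim n)) delta hn k l D).
Qed.
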